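(* Let $P$ be a probability transition kernel on the finite or countable alphabet $G$, with $a_k$, $\beta$, $\rho_m$, $\underline U$, $\tau[j,\infty]$, $\Phi$ defined from $P$ as in the context. Let $\mathbf N\in\{0,1\}^{\mathbb Z}$ be the random counting measure $\mathbf N(j)=\mathbf 1\{\tau[j,\infty]=j\}$, $j\in\mathbb Z$, and let $(T_\ell:\ell\in\mathbb Z)$ be its ordered time events: $\mathbf N(i)=1$ if and only if $i=T_\ell$ for some $\ell$, $T_\ell<T_{\ell+1}$, and $T_0\le 0<T_1$. If $\beta>0$, then the process $\mathbf N$ is a stationary renewal process with renewal distribution $$\mathbb P(T_{\ell+1}-T_\ell\ge m)=\rho_m$$ for $m>0$ and $\ell\ne0$. Furthermore, the random vectors $\xi_\ell\in\bigcup_{n\ge1}G^n$, $\ell\in\mathbb Z$, defined by $$\xi_\ell(\underline U):=\bigl(\Phi(\underline U)(T_\ell),\dots,\Phi(\underline U)(T_{\ell+1}-1)\bigr)$$ are mutually independent, and $(\xi_\ell(\underline U):\ell\ne0)$ are identically distributed.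
   Context: Notation. $\mathbb N=\{0,1,2,\dots\}$, $\mathbb N^*=\mathbb N\setminus\{0\}$, $-\mathbb N^*=\{-i:i\in\mathbb N^*\}$. Intervals $[s,t]$ are intervals of integers; $[s,\infty]$ means all integers $\ge s$. $G$ is a finite or countable set (alphabet), enumerated as $g_1,g_2,\dots$. Elements of $G^{-\mathbb N^*}$ are histories $w_{-\infty}^{-1}=(w_{-1},w_{-2},\dots)$, and $w_{-k}^{-1}=(w_{-1},\dots,w_{-k})$. $P:G\times G^{-\mathbb N^*}\to[0,1]$ is a probability transition kernel: $P(g\mid w_{-\infty}^{-1})\ge 0$ and $\sum_{g\in G}P(g\mid w_{-\infty}^{-1})=1$ for every history (measurable in the history). The numbers $a_k$. $a_0(g)=\inf\{P(g\mid z_{-\infty}^{-1}): z_{-\infty}^{-1}\in G^{-\mathbb N^*}\}$; for $k\ge1$, $a_k(g\mid w_{-k}^{-1})=\inf\{P(g\mid w_{-1},\dots,w_{-k},z_{-1},z_{-2},\dots): z_{-\infty}^{-1}\in G^{-\mathbb N^*}\}$ (for $k=0$, $a_0(g\mid w_0^{-1})$ means $a_0(g)$); and $a_k=\inf_{w_{-k}^{-1}}\sum_{g\in G}a_k(g\mid w_{-k}^{-1})$, $k\in\mathbb N$. Set $\beta=\prod_{k=0}^\infty a_k=\lim_{m\to\infty}\prod_{k=0}^m a_k$. Regeneration times. $\underline U=(U_i)_{i\in\mathbb Z}$ are i.i.d. uniform on $[0,1[$ under $\mathbb P$. For $-\infty<s<\infty$ and $s\le t\le\infty$, $\tau[s,t]=\max\{m\le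 s: U_k<a_{k-m}\text{ for all }k\in[m,t]\}$, with $\max\emptyset=-\infty$. Write $\tau[n]=\tau[n,n]$, and $\tau[n](\underline u)$ for the same quantity computed with a deterministic sequence $\underline u\in[0,1[^{\mathbb Z}$ in place of $\underline U$. The numbers $\rho_m$. $\rho_m$ is the probability that the Markov chain on $\mathbb N$ started at $0$ at time $0$, with transition probabilities $p(x,x+1)=a_x$, $p(x,0)=1-a_x$, and $p(x,y)=0$ otherwise, is at $0$ at time $m$. The map $\Phi$. Put $b_0(g)=a_0(g)$ and, for $k\ge1$, $b_k(g\mid w_{-k}^{-1})=a_k(g\mid w_{-k}^{-1})-a_{k-1}(g\mid w_{-k+1}^{-1})$. For each history, let $\mathbf B_k(g\mid w_{-k}^{-1})$, $k\in\mathbb N$, $g\in G$ (written $\mathbf B_0(g)$ for $k=0$), be the intervals, closed on the left and open on the right, of length $b_k(g\mid w_{-k}^{-1})$, placed consecutively starting at $0$ in the order $\mathbf B_0(g_1),\mathbf B_0(g_2),\dots,\mathbf B_1(g_1\mid w_{-1}^{-1}),\mathbf B_1(g_2\mid w_{-1}^{-1}),\dots,\mathbf B_2(g_1\mid w_{-2}^{-1}),\dots$. For $\ell\le k$ let $\mathbf B_{\ell,k}(g\mid w_{-1},\dots,w_{-k})=[0,a_k[\,\cap\,\mathbf B_\ell(g\mid w_{-\ell}^{-1})$. Fix an arbitrary $g_0\in G$. Then $\Phi(\underline u)=\underline x=(x_n)_{n\in\mathbb Z}$, also written $\Phi(\underline u)(n)=x_n$, where: if $\tau[n](\underline u)=-\infty$,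 $x_n=g_0$; if $\tau=\tau[n](\underline u)>-\infty$, then recursively for $j=\tau,\tau+1,\dots,n$, $x_j$ is the unique $g\in G$ such that $u_j\in\bigcup_{0\le \ell\le j-\tau}\mathbf B_{\ell,j-\tau}(g\mid x_{j-1},\dots,x_\tau)$. Stationary renewal process: a stationary $\{0,1\}$-valued process on $\mathbb Z$ whose successive inter-event gaps $T_{\ell+1}-T_\ell$, $\ell\in\mathbb Z$, are mutually independent, those with $\ell\neq0$ having a common law (the renewal distribution).
   Formalization: The renewal law is stated as P(T_{ℓ+1}−T_ℓ ≥ m) = ρ_{m−1} instead of ρ_m: with ρ as defined, m = 1 would give 1 = ρ_1 = 1 − a_0, which is impossible because a_0 ≥ β > 0. *)

(* Defs.v *)
From HB Require Import structures.
From mathcomp Require Import all_boot all_order all_algebra.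
From mathcomp Require Import all_classical all_reals all_analysis.
Set Implicit Arguments.
Unset Strict Implicit.
Unset Printing Implicit Defensive.
Import Order.TTheory GRing.Theory Num.Theory.
Import numFieldNormedType.Exports.
Local Open Scope classical_set_scope.
Local Open Scope ring_scope.

(** * Transition kernels with infinite memory *)

(* A history w_{-oo}^{-1} is a function [w : nat -> G] with [w i] = w_{-(i+1)};
   a finite past w_{-k}^{-1} is a sequence [:: w_{-1}; ...; w_{-k}], most
   recent symbol first. *)
Definition history (G : Type) := nat -> G.

Definition past_cat (G : Type) (w : seq G) (z : history G) : history G :=
  fun i => nth (z (i - size w)%N) w i.

(* As G is countable and carries the discrete sigma-algebra, the cylinders
   generate the product sigma-algebra. *)
Definition cylinders (G : Type) : set (set (history G)) :=
  [set C | exists (n : nat) (w : history G),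
             C = [set z | forall i, (i < n)%N -> z i = w i]].

Record transition_kernel (R : realType) (G : countType)
    (P : G -> history G -> R) : Prop := TransitionKernel {
  kernel_ge0 : forall g w, 0 <= P g w ;
  kernel_sum1 : forall w, (\esum_(g in [set: G]) (P g w)%:E = 1)%E ;
  kernel_measurable : forall g (B : set R), measurable B ->
    <<s cylinders (G := G)>> (P g @^-1` B) }.

(* a_k(g | w_{-k}^{-1}), with k = size w *)
Definition a_past (R : realType) (G : countType) (P : G -> history G -> R)
    (w : seq G) (g : G) : R :=
  inf [set P g (past_cat w z) | z in [set: history G]].

Definition a_ (R : realType) (G : countType) (P : G -> history G -> R)
    (k : nat) : R :=
  inf [set fine (\esum_(g in [set: G]) (a_past P w g)%:E)%E
      | w in [set: k.-tuple G]].

Definition beta (R : realType) (G : countType) (P : G -> history G -> R) : R :=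
  limn (fun m => \prod_(k < m.+1) a_ P k).

(** * Regeneration times *)

Definition is_max (d : Order.disp_t) (T : porderType d) (A : set T) (x : T) :=
  A x /\ ubound A x.

(* tau[s,t], with values in Z U {-oo}; t ranges over Z U {+oo} *)
Definition tau (R : realType) (a : nat -> R) (u : int -> R)
    (s : int) (t : \bar int) : \bar int :=
  xget -oo%E [set m%:E%E | m in is_max
    [set m : int | m <= s /\
       forall k : int, m <= k -> (k%:E <= t)%E -> u k < a `|k - m|%N]].

(** * The map Phi *)

Definition b_past (R : realType) (G : countType) (P : G -> history G -> R)
    (w : seq G) (g : G) : R :=
  if w is [::] then a_past P [::] g
  else a_past P w g - a_past P (take (size w).-1 w) g.

(* B_l(g | w_{-l}^{-1}) for l <= size w. The enumeration g_1, g_2, ... of G is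
   the one given by its countType structure (increasing values of [pickle]). *)
Definition B_interval (R : realType) (G : countType)
    (P : G -> history G -> R) (l : nat) (g : G) (w : seq G) : set R :=
  let left :=
    \sum_(j < l) fine (\esum_(h in [set: G]) (b_past P (take j w) h)%:E)%E +
    fine (\esum_(h in [set h | (pickle h < pickle g)%N])
            (b_past P (take l w) h)%:E)%E in
  [set` `[left, left + b_past P (take l w) g[].

(* B_{l,k}(g | w_{-1}, ..., w_{-k}), with k = size w *)
Definition B_trunc (R : realType) (G : countType) (P : G -> history G -> R)
    (l : nat) (g : G) (w : seq G) : set R :=
  [set` `[0, a_ P (size w)[] `&` B_interval P l g w.

Definition next_symbol (R : realType) (G : countType)
    (P : G -> history G -> R) (g0 : G) (w : seq G) (v : R) : G :=
  xget g0 [set g | exists2 l : nat, (l <= size w)%N & B_trunc P l g w v].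

(* The sequence x_{m+n-1}, ..., x_m produced by the recursion started at m *)
Fixpoint symbols_from (R : realType) (G : countType)
    (P : G -> history G -> R) (g0 : G) (u : int -> R) (m : int) (n : nat)
    : seq G :=
  if n is n'.+1 then
    let w := symbols_from P g0 u m n' in
    next_symbol P g0 w (u (m + n'%:Z)) :: w
  else [::].

Definition Phi (R : realType) (G : countType) (P : G -> history G -> R)
    (g0 : G) (u : int -> R) (n : int) : G :=
  if tau (a_ P) u n n%:E is m%:E%E then
    head g0 (symbols_from P g0 u m `|n - m|.+1)
  else g0.

(** * The return probabilities *)

Definition house (R : realType) (a : nat -> R) (x y : nat) : R :=
  if y == x.+1 then a x else if y == 0%N then 1 - a x else 0.

(* Law at time n of the Markov chain on nat started at x0 with transition
   matrix p; see [markov_chain_law] below. *)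
Fixpoint chain_law (R : realType) (p : nat -> nat -> R) (x0 : nat) (n : nat)
    (y : nat) : \bar R :=
  if n is n'.+1 then
    (\sum_(0 <= x <oo) chain_law p x0 n' x * (p x y)%:E)%E
  else ((y == x0)%:R)%:E.

(* Pitfall: rho a 0 = 1 and rho a 1 = 1 - a 0. Since the last-zero
   decomposition of the chain reads
   sum_{j <= n} rho_j * prod_{i < n - j} a_i = 1, and an event of the
   regeneration process at 0 is followed by one at n with conditional
   probability prod_{i < n} a_i, the tail of its gaps is P(gap > j) = rho_j,
   that is, P(gap >= m) = rho_{m-1} for m > 0. *)
Definition rho (R : realType) (a : nat -> R) (m : nat) : \bar R :=
  chain_law (house a) 0 m 0.

Record markov_chain (d : measure_display) (T : measurableType d)
    (R : realType) (Pr : probability T R) (p : nat -> nat -> R) (x0 : nat)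
    (X : nat -> T -> nat) : Prop := MarkovChain {
  chain_measurable : forall n A, measurable (X n @^-1` A) ;
  chain_init : Pr (X 0%N @^-1` [set x0]) = 1%E ;
  chain_step : forall n (x : nat -> nat) y,
    Pr ([set w | forall i, (i <= n)%N -> X i w = x i] `&` X n.+1 @^-1` [set y])
    = (Pr [set w | forall i, (i <= n)%N -> X i w = x i] * (p (x n) y)%:E)%E }.

Lemma measure_split_nat (d : measure_display) (T : measurableType d)
    (R : realType) (Pr : probability T R) (X : T -> nat) (A : set T) :
  (forall B, measurable (X @^-1` B)) -> measurable A ->
  Pr A = (\sum_(0 <= v <oo) Pr (A `&` X @^-1` [set v]))%E.
Proof.
move=> mX mA; rewrite -measure_semi_bigcup.
- by rewrite -setI_bigcupr -preimage_bigcup bigcup_imset1 image_id preimage_setT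
    setIT.
- by move=> v; apply: measurableI.
- apply/trivIsetP => i j _ _ ij; rewrite -subset0 => w [[_ /= wi] [_ /= wj]].
  by move: ij; rewrite -wi -wj eqxx.
- by apply: bigcup_measurable => v _; apply: measurableI.
Qed.

Section markov_chain_marginals.
Context (d : measure_display) (T : measurableType d) (R : realType)
  (Pr : probability T R) (p : nat -> nat -> R) (x0 : nat) (X : nat -> T -> nat).
Hypotheses (p_ge0 : forall x y, 0 <= p x y) (hX : markov_chain Pr p x0 X).

Let path_event (k n : nat) (x : nat -> nat) : set T :=
  [set w | forall i, (k <= i <= n)%N -> X i w = x i].

Let measurable_path_event k n x : measurable (path_event k n x).
Proof.
have -> : path_event k n x =
    \bigcap_(i in [set i | (k <= i <= n)%N]) (X i @^-1` [set x i]).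
  by apply/seteqP; split => w hw i /= hi; exact: hw.
by apply: bigcap_measurableType => i _; exact: chain_measurable hX i _.
Qed.

Let chain_step_from k n x y : (k <= n)%N ->
  Pr (path_event k n x `&` X n.+1 @^-1` [set y]) =
  (Pr (path_event k n x) * (p (x n) y)%:E)%E.
Proof.
elim: k x => [|k IHk] x lekn; first exact: (chain_step hX).
pose xv v i := if i == k then v else x i.
have split_event v : path_event k.+1 n x `&` X k @^-1` [set v] =
    path_event k n (xv v).
  apply/seteqP; split => w.
    move=> [hw /= hv] i /andP[ki iin]; rewrite /xv; case: eqP => [->//|/eqP ik].
    by apply: hw; rewrite iin ltn_neqAle eq_sym ik ki.
  move=> hw; split; last by rewrite /= hw ?leqnn ?(ltnW lekn)// /xv eqxx.
  move=> i /andP[ki iin]; rewrite hw ?iin ?(ltnW ki)// /xv.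
  by rewrite gtn_eqF.
have mX B : measurable (X k @^-1` B) by exact: chain_measurable hX k B.
rewrite (measure_split_nat Pr mX (measurableI _ _ (measurable_path_event _ _ _)
  (chain_measurable hX _ _))).
rewrite [in RHS](measure_split_nat Pr mX (measurable_path_event _ _ _)).
rewrite muleC -nneseriesZl; last by move=> v _; exact: measure_ge0.
apply: eq_eseriesr => v _.
rewrite setIAC split_event IHk ?(ltnW lekn)// muleC /xv gtn_eqF//.
Qed.

Lemma markov_chain_law n y : Pr (X n @^-1` [set y]) = chain_law p x0 n y.
Proof.
have mX i B : measurable (X i @^-1` B) by exact: chain_measurable hX i B.
elim: n y => [|n IHn] y /=.
  have [->|yx0] := eqVneq y x0; first exact: chain_init hX.
  apply/eqP; rewrite mulr0n eq_le measure_ge0 andbT.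
  have h0 : Pr (~` (X 0%N @^-1` [set x0])) = 0%E.
    by rewrite probability_setC// (chain_init hX) subee.
  rewrite -[leRHS]h0.
  apply: le_measure; rewrite ?inE//; first exact: measurableC.
  by move=> w /= -> /eqP; rewrite (negbTE yx0).
rewrite (measure_split_nat Pr (mX n) (mX n.+1 _)).
apply: eq_eseriesr => x _; rewrite -IHn setIC.
have -> : X n @^-1` [set x] = path_event n n (fun=> x).
  apply/seteqP; split => w /= hw; last by apply: hw; rewrite leqnn.
  by move=> i; rewrite -eqn_leq => /eqP <-.
exact: (chain_step_from (fun=> x) y (leqnn n)).
Qed.

End markov_chain_marginals.

(** * Probabilistic notions *)

(* The target space E is given with its sigma-algebra S. *)
Definition mutually_independent (d : measure_display) (T : measurableType d)
    (R : realType) (Pr : probability T R) (I : choiceType) (E : Type)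
    (S : set (set E)) (X : I -> T -> E) : Prop :=
  (forall i A, S A -> measurable (X i @^-1` A)) /\
  forall (s : seq I) (A : I -> set E), uniq s -> (forall i, S (A i)) ->
    Pr (\bigcap_(i in [set` s]) (X i @^-1` A i)) =
    (\prod_(i <- s) Pr (X i @^-1` A i))%E.

Definition identically_distributed (d : measure_display)
    (T : measurableType d) (R : realType) (Pr : probability T R) (I E : Type)
    (J : set I) (S : set (set E)) (X : I -> T -> E) : Prop :=
  forall i j, J i -> J j -> forall A, S A ->
    Pr (X i @^-1` A) = Pr (X j @^-1` A).

Definition iid_uniform01 (d : measure_display) (T : measurableType d)
    (R : realType) (Pr : probability T R) (U : int -> {RV Pr >-> R}) : Prop :=
  mutually_independent Pr (measurable : set (set R)) (fun i => U i : T -> R) /\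
  forall i (A : set R), measurable A ->
    distribution Pr (U i) A = uniform_prob (@ltr01 R) A.

Definition stationary (d : measure_display) (T : measurableType d)
    (R : realType) (Pr : probability T R) (N : T -> int -> bool) : Prop :=
  (forall j, measurable [set w | N w j]) /\
  forall (s : seq int) (x : int -> bool) (h : int),
    Pr [set w | forall i, i \in s -> N w (i + h) = x i] =
    Pr [set w | forall i, i \in s -> N w i = x i].

(** * Renewal processes *)

Definition is_event_times (n : int -> bool) (t : int -> int) : Prop :=
  [/\ forall i, n i <-> exists l, i = t l,
      forall l, t l < t (l + 1) & t 0 <= 0 < t 1].

(* Configurations whose events are not unbounded in both directions have no
   such enumeration; the value [id] chosen for them is irrelevant. *)
Definition event_times (n : int -> bool) : int -> int :=
  xget (id : int -> int) (is_event_times n).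

Definition gap (n : int -> bool) (l : int) : int :=
  event_times n (l + 1) - event_times n l.

Record stationary_renewal (d : measure_display) (T : measurableType d)
    (R : realType) (Pr : probability T R) (N : T -> int -> bool) : Prop :=
  StationaryRenewal {
  renewal_stationary : stationary Pr N ;
  renewal_events : {ae Pr, forall w, exists t, is_event_times (N w) t} ;
  renewal_indep : mutually_independent Pr (discrete_measurable (T := int))
    (fun (l : int) w => gap (N w) l) ;
  renewal_law : identically_distributed Pr [set l : int | l != 0]
    (discrete_measurable (T := int)) (fun (l : int) w => gap (N w) l) }.

Definition regeneration (R : realType) (a : nat -> R) (u : int -> R)
    (j : int) : bool :=
  tau a u j +oo%E == j%:E%E.

(* xi_l, an element of the union of the G^n, encoded as a sequence over G *)
Definition block (R : realType) (G : countType) (P : G -> history G -> R)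
    (g0 : G) (u : int -> R) (l : int) : seq G :=
  let n := regeneration (a_ P) u in
  [seq Phi P g0 u (event_times n l + i%:Z) | i <- iota 0 `|gap n l|].

(* Main.v *)
(* Write A_i for the event that i is a regeneration time: U_k < a_{k-i} for all
   k >= i. As (a_k) is nondecreasing, when A_j holds and i < j, whether A_i
   holds depends only on the coordinates in [i,j[, and on A_i so does Phi on
   [i,j[. Hence, given A_j, that i is the event preceding j and that the block
   from i to j lies in B is an event of the coordinates in [i,j[, and the joint
   law of the blocks around the origin factorizes: to the left of T_0 these
   events concern the past only, to the right of T_1 the future only.

   Almost surely there are infinitely many events on both sides: a failure at a
   finite time is independent of what follows, so the probability q of having no
   event after a given time satisfies q <= (1 - P(A_0)) q; and a first event
   would be located uniformly on the integers.

   For the law of the gaps, decomposing A_0 according to the last event before n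
   gives sum_{k <= n} (prod_{i < k} a_i) P(A_0, no event in ]0,n-k]) = P(A_0).
   The return probabilities of the house-of-cards chain satisfy the same
   triangular system with right-hand side 1. *)

Require Import Defs.
From HB Require Import structures.
From mathcomp Require Import all_boot all_order all_algebra.
From mathcomp Require Import all_classical all_reals all_analysis.
From mathcomp Require Import zify lra.
Import Order.TTheory GRing.Theory Num.Theory.
Import numFieldNormedType.Exports.
Local Open Scope classical_set_scope.
Local Open Scope ring_scope.
Set Implicit Arguments.
Unset Strict Implicit.
Unset Printing Implicit Defensive.

(** * Measurability of predicates, and sums over countably many cases *)

Section measurable_predicates.
Context d (T : measurableType d).
Implicit Types F G : T -> Prop.

Lemma measurable_ex (I : countType) (F : I -> T -> Prop) :
  (forall i, measurable [set x | F i x]) -> measurable [set x | exists i, F i x].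
Proof.
move=> mF; rewrite (_ : mkset _ = \bigcup_i [set x | F i x]).
  exact: countable_bigcupT_measurable.
by apply/seteqP; split=> x /= [i]; exists i.
Qed.

Lemma measurable_not F : measurable [set x | F x] -> measurable [set x | ~ F x].
Proof. exact: measurableC. Qed.

Lemma measurable_all (I : countType) (F : I -> T -> Prop) :
  (forall i, measurable [set x | F i x]) -> measurable [set x | forall i, F i x].
Proof.
move=> mF; rewrite (_ : mkset _ = [set x | ~ exists i, ~ F i x]).
  by apply: measurable_not; apply: measurable_ex => i; exact: measurable_not.
apply/seteqP; split=> x /= h; first by case.
by move=> i; apply: contrapT => Fi; apply: h; exists i.
Qed.

Lemma measurable_conj F G : measurable [set x | F x] ->
  measurable [set x | G x] -> measurable [set x | F x /\ G x].
Proof. exact: measurableI. Qed.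

Lemma measurable_disj F G : measurable [set x | F x] ->
  measurable [set x | G x] -> measurable [set x | F x \/ G x].
Proof. exact: measurableU. Qed.

Lemma measurable_const (P : Prop) : measurable [set _ : T | P].
Proof.
have [p|np] := pselect P.
  by rewrite (_ : mkset _ = setT)//; apply/seteqP; split.
by rewrite (_ : mkset _ = set0)//; apply/seteqP; split.
Qed.

Lemma measurable_imp (P : Prop) F : measurable [set x | F x] ->
  measurable [set x | P -> F x].
Proof.
move=> mF; rewrite (_ : mkset _ = [set x | ~ P \/ F x]).
  by apply: measurable_disj => //; exact: measurable_const.
apply/seteqP; split=> x /= => [h|[//|//]].
by have [p|] := pselect P; [right; exact: h|left].
Qed.

End measurable_predicates.

(** Countable additivity over the cases of an existential; ordering the two indices lets each
    disjointness proof treat [m < n] only. *)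
Lemma probability_ex d (T : measurableType d) (R : realType)
    (Q : probability T R) (F : nat -> T -> Prop) :
  (forall n, measurable [set x | F n x]) ->
  (forall m n x, (m < n)%N -> F m x -> F n x -> False) ->
  Q [set x | exists n, F n x] = (\sum_(n <oo) Q [set x | F n x])%E.
Proof.
move=> mF dF; rewrite -measure_semi_bigcup//.
- by congr (Q _); apply/seteqP; split=> x /= [n]; exists n.
- apply/trivIsetP => m n _ _; rewrite neq_ltn => mn.
  rewrite -subset0 => x [/= Fm Fn].
  by move: mn => /orP[] /dF; [apply; [exact: Fm|]|apply; [exact: Fn|]].
- exact: bigcupT_measurable.
Qed.

Lemma nneseriesMr (R : realType) (f : nat -> \bar R) (c : \bar R) :
  (forall n, (0 <= f n)%E) -> c \is a fin_num ->
  (\sum_(n <oo) (f n * c) = (\sum_(n <oo) f n) * c)%E.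
Proof.
move=> f0 /fineK <-; rewrite muleC -nneseriesZl//.
by apply: eq_eseriesr => n _; rewrite muleC.
Qed.

(** * Independence and stationarity of the trajectory *)

Section trajectories.
Context (R : realType).

(** Finite-dimensional cylinders with base in [J]. The base is a duplicate-free list, so that the
    product formula for i.i.d. coordinates applies to it directly. *)
Definition cylinder (J : pred int) : set (set (int -> R)) :=
  [set E | exists s (A : int -> set R), [/\ uniq s, {subset s <= J},
    forall i, measurable (A i) &
    E = \bigcap_(i in [set` s]) [set u | A i (u i)]]].

(** Real sequences indexed by the integers, with the product sigma-algebra. *)
Definition trajectory := g_sigma_algebraType (cylinder predT).


Lemma cylinder_coord J i B : i \in J -> measurable B ->
  cylinder J [set u : int -> R | B (u i)].
Proof.
move=> iJ mB; exists [:: i], (fun=> B); split => //.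
  by move=> j; rewrite inE => /eqP ->.
apply/seteqP; split=> [u Bu j /=|u]; first by rewrite inE => /eqP ->.
by apply; rewrite /= inE.
Qed.

Lemma cylinderT J : cylinder J setT.
Proof.
exists [::], (fun=> setT); split => //.
by apply/seteqP; split=> u.
Qed.

Lemma cylinder_setI J : setI_closed (cylinder J).
Proof.
move=> _ _ [s1 [A1 [u1 s1J mA1 ->]]] [s2 [A2 [u2 s2J mA2 ->]]].
exists (undup (s1 ++ s2)), (fun i => (if i \in s1 then A1 i else setT) `&`
  (if i \in s2 then A2 i else setT)); split.
- exact: undup_uniq.
- by move=> i; rewrite mem_undup mem_cat => /orP[/s1J|/s2J].
- by move=> i; apply: measurableI; case: ifP.
- apply/seteqP; split=> u /=.
    move=> [h1 h2] i /=; rewrite mem_undup mem_cat => /orP[] ii; split;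
      by case: ifPn => // ij; (exact: h1 || exact: h2).
  move=> h; split=> i /= ii.
    by have := h i; rewrite /= mem_undup mem_cat ii /= => /(_ isT)[].
  by have := h i; rewrite /= mem_undup mem_cat ii orbT /= => /(_ isT)[].
Qed.

Lemma measurable_coord i B : measurable B ->
  measurable ([set u : trajectory | B (u i)]).
Proof. by move=> mB; apply: sub_sigma_algebra; exact: cylinder_coord. Qed.

Lemma measurable_into_trajectory d (T : measurableType d) (f : T -> trajectory) :
  (forall i B, measurable B -> measurable [set w | B (f w i)]) ->
  measurable_fun setT f.
Proof.
move=> mf; apply: (@measurability _ _ T trajectory setT f (cylinder predT)) => //.
move=> _ [_ [s [A [_ _ mA ->]]] <-]; rewrite setTI preimage_bigcap.
apply: fin_bigcap_measurable => [|i _]; last exact: mf.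
exact: finite_seq.
Qed.

Lemma cylinder_measurable J : cylinder J `<=` (measurable : set (set trajectory)).
Proof.
move=> _ [s [A [_ _ mA ->]]].
apply: fin_bigcap_measurable => [|i _]; last exact: measurable_coord.
exact: finite_seq.
Qed.

(** One implication is enough, [u] and [u'] being exchangeable. *)
Definition depends_on (J : pred int) (E : set trajectory) :=
  forall u u' : trajectory, {in J, u =1 u'} -> E u -> E u'.

(* Replacing the coordinates outside [J] by a constant is measurable from the
   sigma-algebra of the coordinates in [J] to that of all coordinates. *)
Lemma depends_on_sigma J (E : set trajectory) : measurable E -> depends_on J E ->
  <<s cylinder J >> E.
Proof.
move=> mE dE.
pose phi (u : g_sigma_algebraType (cylinder J)) : trajectory :=
  fun i => if i \in J then u i else 0.
have mphi : measurable_fun setT phi.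
  apply: measurable_into_trajectory => i B mB; rewrite /phi.
  case: (boolP (i \in J)) => iJ; last exact: measurable_const.
  by apply: sub_sigma_algebra; exact: cylinder_coord.
have := mphi measurableT E mE; rewrite setTI.
suff -> : phi @^-1` E = E by [].
apply/seteqP; split=> u /= Eu; apply: dE Eu => i iJ; rewrite /phi ifT//.
Qed.

End trajectories.

(** As functions of [E], both sides are finite measures: the restriction of [Q] to [F] and a
    multiple of [Q]. They agree on the pi-system [G], hence on the sigma-algebra it generates. *)
Lemma independent_sigma d (T : measurableType d) (R : realType)
    (Q : probability T R) (G : set (set T)) (F : set T) :
  G `<=` measurable -> setI_closed G -> G setT -> measurable F ->
  (forall C, G C -> Q (C `&` F) = (Q C * Q F)%E) ->
  forall E, <<s G >> E -> Q (E `&` F) = (Q E * Q F)%E.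
Proof.
move=> Gm GI GT mF GF E GE.
pose r : {nonneg R} := NngNum (fine_ge0 (measure_ge0 Q F)).
have QFE : Q F = (r%:num)%:E by rewrite /= fineK// fin_num_measure.
have GFE A : mscale r Q A = (Q A * Q F)%E.
  by rewrite /mscale/= muleC QFE.
have mainE : mrestr Q mF E = mscale r Q E.
  apply: (g_sigma_algebra_measure_unique G Gm (fun=> setT)) => //.
  - by rewrite bigcup_const//; exists 0%N.
  - by move=> A GA; exact: etrans (GF A GA) (esym (GFE A)).
  - by move=> _; rewrite [ltLHS](_ : _ = Q (setT `&` F))// setTI ltey_eq
      fin_num_measure.
exact: etrans mainE (GFE E).
Qed.

Section iid_trajectory.
Context (R : realType) (Q : probability (trajectory R) R) (lam : set R -> \bar R).
Hypothesis iidQ : forall s (A : int -> set R), uniq s ->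
  (forall i, measurable (A i)) ->
  Q (\bigcap_(i in [set` s]) [set u : trajectory R | A i (u i)]) =
  (\prod_(i <- s) lam (A i))%E.

(** [independent_sigma] extends the identity from cylinders in one argument at a time. For two
    cylinders with disjoint bases, the product formula over the concatenated base splits. *)
Lemma trajectory_independent (J1 J2 : pred int) (E1 E2 : set (trajectory R)) :
  (forall i, i \in J1 -> i \notin J2) ->
  measurable E1 -> measurable E2 -> depends_on J1 E1 -> depends_on J2 E2 ->
  Q (E1 `&` E2) = (Q E1 * Q E2)%E.
Proof.
move=> J12 mE1 mE2 /(depends_on_sigma mE1) sE1 /(depends_on_sigma mE2) sE2.
move: E1 sE1 {mE1}; apply: independent_sigma => //.
- exact: cylinder_measurable.
- exact: cylinder_setI.
- exact: cylinderT.
move=> C GC; rewrite setIC muleC.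
have mC := cylinder_measurable GC.
move: E2 sE2 {mE2}; apply: independent_sigma => //.
- exact: cylinder_measurable.
- exact: cylinder_setI.
- exact: cylinderT.
case: GC => s1 [A1 [u1 s1J mA1 ->]] {mC} _ [s2 [A2 [u2 s2J mA2 ->]]].
(* One family for both bases: as they are disjoint, giving priority to [A2] loses no condition of
   [A1]. *)
pose A i := if i \in s2 then A2 i else A1 i.
rewrite !iidQ// [X in Q X](_ : _ = \bigcap_(i in [set` s2 ++ s1])
  [set u : trajectory R | A i (u i)]); last first.
  rewrite /A; apply/seteqP; split=> u /= h; last first.
    split=> i /= ii; have := h i; rewrite /= mem_cat ii ?orbT => /(_ isT)//.
    by rewrite ifN//; apply: contraL (J12 i (s1J _ ii)) => /s2J; rewrite negbK.
  move=> i /=; rewrite mem_cat; case: ifPn => [i2 _|_ /= i1]; first exact: h.1.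
  exact: h.2.
rewrite iidQ /A.
- rewrite big_cat; congr (_ * _)%E; apply: eq_big_seq => i ii; first by rewrite ii.
  by rewrite ifN//; apply: contraL (J12 i (s1J _ ii)) => /s2J; rewrite negbK.
- rewrite cat_uniq u1 u2 andbT/=; apply/hasPn => i i1.
  by apply: contraL (J12 i (s1J _ i1)) => /s2J; rewrite negbK.
- by move=> i; case: ifP.
Qed.

Definition shift (h : int) (u : trajectory R) : trajectory R := fun k => u (k + h).

Lemma measurable_shift h : measurable_fun setT (shift h).
Proof. by apply: measurable_into_trajectory => i B; exact: measurable_coord. Qed.

(** The marginal [lam] is the same at every coordinate, so the image of [Q] under the shift agrees
    with [Q] on cylinders, hence everywhere. *)
Lemma trajectory_stationary h (E : set (trajectory R)) : measurable E ->
  Q (shift h @^-1` E) = Q E.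
Proof.
move=> mE.
pose mX := measurable_shift h.
pose sh : {mfun trajectory R >-> trajectory R} := HB.pack (shift h)
  (@isMeasurableFun.Build _ _ _ _ (shift h) mX).
have := @measure_unique _ R (trajectory R) (cylinder predT) (fun=> setT) _
  (@cylinder_setI _ _) (fun=> cylinderT _ _) _ (distribution Q sh) Q.
rewrite /distribution /pushforward /=; apply => //.
- by rewrite bigcup_const//; exists 0%N.
- move=> _ [s [A [us _ mA ->]]].
  transitivity (Q (\bigcap_(i in [set` [seq j + h | j <- s]])
      [set u : trajectory R | A (i - h) (u i)])); last first.
    rewrite (iidQ (A := fun i => A (i - h)))//.
      by rewrite iidQ// big_map; apply: eq_bigr => i _; rewrite addrK.
    by rewrite map_inj_uniq//; exact: addIr.
  congr (Q _); apply/seteqP; split=> u /= hu i /=.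
    by move=> /mapP[j js ->]; rewrite addrK; exact: hu.
  move=> js; have := hu (i + h); rewrite /= addrK; apply.
  exact: map_f.
- move=> _; rewrite [ltLHS](_ : _ = Q (shift h @^-1` setT))//.
  by rewrite preimage_setT ltey_eq fin_num_measure.
Qed.

End iid_trajectory.

(** * Regeneration times and excursions *)

Section regeneration_times.
Context (R : realType) (a : nat -> R).
Hypothesis a_nd : forall m n, (m <= n)%N -> a m <= a n.
Implicit Types (u : trajectory R) (i j k : int).

(** The part of [regen u i] that is read on the coordinates in [i,j[: just before time [j], the
    candidate [i] has not been ruled out. *)
Definition below u i j := forall k, i <= k -> k < j -> u k < a `|k - i|.

Definition regen u i := forall k, i <= k -> u k < a `|k - i|.

Lemma tauP u (s : int) (t : \bar int) (m : int) :
  tau a u s t = m%:E%E <->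
  is_max [set m : int | m <= s /\
    forall k : int, m <= k -> (k%:E <= t)%E -> u k < a `|k - m|%N] m.
Proof.
rewrite /tau; case: xgetP => [_ -> [m' mm' <-]|noM].
  split=> [[<-]//|mm]; congr (_%:E)%E; apply/eqP; rewrite eq_le.
  by rewrite (mm.2 _ mm'.1) (mm'.2 _ mm.1).
by split=> [//|mm]; case: (noM (m%:E)%E); exists m.
Qed.

Lemma regenerationP u j : regeneration a u j <-> regen u j.
Proof.
rewrite /regeneration; split=> [/eqP/tauP[[_ hj] _] k jk|hj].
  by apply: hj => //; rewrite leey.
apply/eqP/tauP; split; last by move=> k [].
by split=> // k jk _; exact: hj.
Qed.

Lemma regen_below u i j : regen u i -> below u i j.
Proof. by move=> h k ik _; exact: h. Qed.

(** From [j] on, the threshold counted from [i] is at least the one counted from [j], because [a] is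
    nondecreasing. So, given an event at [j], the coordinates in [i,j[ alone decide whether [i] is
    an event. *)
Lemma below_regen u i j : i <= j -> below u i j -> regen u j -> regen u i.
Proof.
move=> ij hij hj k ik; have [kj|jk] := ltP k j; first exact: hij.
by apply: lt_le_trans (hj k jk) _; apply: a_nd; lia.
Qed.

Lemma below_ext u u' i j : (forall k, i <= k -> k < j -> u k = u' k) ->
  below u i j -> below u' i j.
Proof. by move=> e h k ik kj; rewrite -e//; exact: h. Qed.

Lemma regen_ext u u' i : (forall k, i <= k -> u k = u' k) ->
  regen u i -> regen u' i.
Proof. by move=> e h k ik; rewrite -e//; exact: h. Qed.

Lemma below_shift u h i j : below (shift h u) i j <-> below u (i + h) (j + h).
Proof.
split=> H k ik kj.
  have := H (k - h); rewrite /shift subrK => {}H.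
  by rewrite (_ : k - (i + h) = k - h - i); [apply: H; lia|lia].
by rewrite /shift (_ : k - i = k + h - (i + h)); [apply: H; lia|lia].
Qed.

Lemma regen_shift u h i : regen (shift h u) i <-> regen u (i + h).
Proof.
split=> H k ik.
  have := H (k - h); rewrite /shift subrK => {}H.
  by rewrite (_ : k - (i + h) = k - h - i); [apply: H; lia|lia].
by rewrite /shift (_ : k - i = k + h - (i + h)); [apply: H; lia|lia].
Qed.

Lemma measurable_lt_coord k (x : R) : measurable [set u : trajectory R | u k < x].
Proof.
rewrite (_ : mkset _ = [set u : trajectory R | [set` `]-oo, x[%R] (u k)]).
  by apply: measurable_coord; exact: measurable_itv.
by apply/seteqP; split=> u /=; rewrite in_itv.
Qed.

Lemma measurable_below i j : measurable [set u | below u i j].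
Proof.
apply: measurable_all => k; do 2 apply: measurable_imp.
exact: measurable_lt_coord.
Qed.

Lemma measurable_regen i : measurable [set u | regen u i].
Proof.
apply: measurable_all => k; apply: measurable_imp; exact: measurable_lt_coord.
Qed.

(** * Excursions between consecutive events, for an abstract process [psi] in the role of [Phi] *)

Section excursions.
Context (G : countType) (psi : trajectory R -> int -> G).
Hypothesis measurable_psi : forall n g, measurable [set u | psi u n = g].
Hypothesis psi_shift : forall h u n, psi (shift h u) n = psi u (n + h).
Hypothesis psi_local : forall u u' i n, i <= n -> below u i (n + 1) ->
  (forall k, i <= k <= n -> u k = u' k) -> psi u n = psi u' n.

Definition segment u i j : seq G :=
  [seq psi u (i + n%:Z) | n <- iota 0 `|j - i|].

(** Phrased with [below] instead of [regen], so as to concern only the coordinates in [i,j[. Given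
    an event at [j > i], it says that [i] is the preceding event and that the block in between lies
    in [B]; see [excursion_regen]. *)
Definition excursion u i j (B : set (seq G)) :=
  [/\ below u i j, forall k, i < k -> k < j -> ~ below u k j & B (segment u i j)].

Lemma segment_shift u h i j : segment (shift h u) i j = segment u (i + h) (j + h).
Proof.
rewrite /segment (_ : j + h - (i + h) = j - i); last lia.
by apply: eq_map => n; rewrite psi_shift; congr (psi u); lia.
Qed.

Lemma segment_ext u u' i j : below u i j ->
  (forall k, i <= k -> k < j -> u k = u' k) -> i <= j ->
  segment u i j = segment u' i j.
Proof.
move=> h e ij; apply/eq_in_map => n; rewrite mem_iota => /andP[_ nij].
apply: (psi_local (i := i)); first by lia.
  by move=> k ik kj; apply: h => //; lia.
by move=> k /andP[ik kj]; apply: e => //; lia.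
Qed.

Lemma excursion_shift u h i j B :
  excursion (shift h u) i j B <-> excursion u (i + h) (j + h) B.
Proof.
rewrite /excursion segment_shift.
split=> -[h1 h2 h3]; split=> //; try exact/below_shift.
  move=> k ik kj hk; apply: (h2 (k - h)); [lia|lia|].
  by apply/below_shift; rewrite subrK.
by move=> k ik kj /below_shift; apply: h2; lia.
Qed.

Lemma excursion_ext u u' i j B : i <= j ->
  (forall k, i <= k -> k < j -> u k = u' k) ->
  excursion u i j B -> excursion u' i j B.
Proof.
move=> ij e [h1 h2 h3]; split.
- exact: below_ext h1.
- move=> k ik kj hk; apply: (h2 k ik kj); apply: below_ext hk => l kl lj.
  by rewrite e//; lia.
- by rewrite -(segment_ext h1).
Qed.

(** Words over a countable alphabet are countable in number, so an arbitrary [B] is treated as a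
    union over its words. *)
Lemma measurable_segment i j B : measurable [set u | B (segment u i j)].
Proof.
rewrite (_ : mkset _ = [set u | exists s, B s /\ segment u i j = s]); last first.
  apply/seteqP; split=> u /=; first by exists (segment u i j).
  by move=> [s [Bs ->]].
apply: measurable_ex => s; apply: measurable_conj; first exact: measurable_const.
rewrite /segment; elim: (iota 0 _) s => [|n ns IH] [|g s].
- by rewrite /=; exact: measurable_const.
- by rewrite /=; exact: measurable_const.
- by rewrite (_ : mkset _ = set0)//; apply/seteqP; split.
rewrite (_ : mkset _ = [set u | psi u (i + n%:Z) = g /\
    [seq psi u (i + n%:Z) | n <- ns] = s]); last first.
  by apply/seteqP; split=> u /= [-> ->].
exact: measurable_conj.
Qed.

Lemma measurable_excursion i j B : measurable [set u | excursion u i j B].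
Proof.
rewrite (_ : mkset _ = [set u | below u i j /\ (forall k, i < k -> k < j ->
  ~ below u k j) /\ B (segment u i j)]); last first.
  by apply/seteqP; split=> u /= => [[h1 h2 h3]|[h1 [h2 h3]]]; split.
apply: measurable_conj; first exact: measurable_below.
apply: measurable_conj; last exact: measurable_segment.
apply: measurable_all => k; do 2 apply: measurable_imp.
by apply: measurable_not; exact: measurable_below.
Qed.

Section windows.
Variable A : int -> set (seq G).

(* In [past_blocks r l j] the event at [j] is numbered [l], so that the [r]
   blocks preceding it have numbers [l - 1], ..., [l - r]; in [future_blocks] the
   block starting at [j] is the one numbered [l]. *)
Fixpoint past_blocks (r : nat) (l : int) (j : int) (u : trajectory R) : Prop :=
  if r is r'.+1 then exists n : nat, excursion u (j - n.+1%:Z) j (A (l - 1)) /\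
    past_blocks r' (l - 1) (j - n.+1%:Z) u
  else True.

Fixpoint future_blocks (r : nat) (l : int) (j : int) (u : trajectory R) : Prop :=
  if r is r'.+1 then exists n : nat, excursion u j (j + n.+1%:Z) (A l) /\
    future_blocks r' (l + 1) (j + n.+1%:Z) u
  else regen u j.

Lemma measurable_past_blocks r l j : measurable [set u | past_blocks r l j u].
Proof.
elim: r l j => [|r IH] l j /=; first exact: measurable_const.
apply: measurable_ex => n; apply: measurable_conj => //.
exact: measurable_excursion.
Qed.

Lemma measurable_future_blocks r l j :
  measurable [set u | future_blocks r l j u].
Proof.
elim: r l j => [|r IH] l j /=; first exact: measurable_regen.
apply: measurable_ex => n; apply: measurable_conj => //.
exact: measurable_excursion.
Qed.

Lemma past_blocks_ext r l j u u' : (forall k, k < j -> u k = u' k) ->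
  past_blocks r l j u -> past_blocks r l j u'.
Proof.
elim: r l j => [//|r IH] l j e [n [h1 h2]]; exists n; split.
  by apply: excursion_ext h1 => [|k _ kj]; [lia|exact: e].
by apply: IH h2 => k kj; apply: e; lia.
Qed.

Lemma future_blocks_ext r l j u u' : (forall k, j <= k -> u k = u' k) ->
  future_blocks r l j u -> future_blocks r l j u'.
Proof.
elim: r l j => [|r IH] l j e; first exact: regen_ext.
move=> [n [h1 h2]]; exists n; split.
  by apply: excursion_ext h1 => [|k jk _]; [lia|exact: e].
by apply: IH h2 => k kj; apply: e; lia.
Qed.

(** [below_regen] carries the final event back over each excursion. *)
Lemma future_blocks_regen r l j u : future_blocks r l j u -> regen u j.
Proof.
elim: r l j => [//|r IH] l j [n [[h1 _ _] /IH h2]].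
by apply: below_regen h1 h2; lia.
Qed.

End windows.
End excursions.
End regeneration_times.

(** * Enumeration of the events *)

Section event_times.
Context (R : realType) (a : nat -> R).
Hypothesis a_nd : forall m n, (m <= n)%N -> a m <= a n.
Implicit Types (u : trajectory R) (i j k l : int).

Definition recurrent u := (forall m, exists2 k, m <= k & regen a u k) /\
  (forall m, exists2 k, k <= m & regen a u k).

Lemma measurable_recurrent : measurable [set u | recurrent u].
Proof.
apply: measurable_conj; apply: measurable_all => m.
  rewrite (_ : mkset _ = [set u | exists k, m <= k /\ regen a u k]).
    apply: measurable_ex => k; apply: measurable_conj; first exact: measurable_const.
    exact: measurable_regen.
  by apply/seteqP; split=> u /= [k]; [exists k|case; exists k].
rewrite (_ : mkset _ = [set u | exists k, k <= m /\ regen a u k]).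
  apply: measurable_ex => k; apply: measurable_conj; first exact: measurable_const.
  exact: measurable_regen.
by apply/seteqP; split=> u /= [k]; [exists k|case; exists k].
Qed.

Lemma next_regen u j : recurrent u ->
  exists n : nat, regen a u (j + n.+1%:Z) /\
    forall k, j < k -> k < j + n.+1%:Z -> ~ regen a u k.
Proof.
move=> [/(_ (j + 1))[k jk rk] _].
have ex : exists n : nat, `[< regen a u (j + n.+1%:Z) >].
  exists (absz (k - j - 1)%R); apply/asboolP.
  by rewrite (_ : j + _ = k)//; lia.
case: (ex_minnP ex) => n /asboolP rn min; exists n; split=> // i ji ijn ri.
have := min (absz (i - j - 1)%R); rewrite leqNgt.
rewrite (_ : (absz (i - j - 1)%R < n)%N); last lia.
rewrite (_ : j + (absz (i - j - 1)%R).+1%:Z = i); last lia.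
by move=> h; apply/negP: isT; apply: h; exact/asboolP.
Qed.

Lemma prev_regen u j : recurrent u ->
  exists n : nat, regen a u (j - n.+1%:Z) /\
    forall k, j - n.+1%:Z < k -> k < j -> ~ regen a u k.
Proof.
move=> [_ /(_ (j - 1))[k jk rk]].
have ex : exists n : nat, `[< regen a u (j - n.+1%:Z) >].
  exists (absz (j - k - 1)%R); apply/asboolP.
  by rewrite (_ : j - _ = k)//; lia.
case: (ex_minnP ex) => n /asboolP rn min; exists n; split=> // i ji ijn ri.
have := min (absz (j - i - 1)%R); rewrite leqNgt.
rewrite (_ : (absz (j - i - 1)%R < n)%N); last lia.
rewrite (_ : j - (absz (j - i - 1)%R).+1%:Z = i); last lia.
by move=> h; apply/negP: isT; apply: h; exact/asboolP.
Qed.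

(** Number 0 goes to the last event before 1; the maps to the next and to the previous event,
    iterated from there, produce all the others. *)
Lemma recurrent_event_times u : recurrent u ->
  exists t, is_event_times (regeneration a u) t.
Proof.
move=> ru; have /choice[nx nxP] := fun j => next_regen j ru.
have /choice[pv pvP] := fun j => prev_regen j ru.
pose t0 : int := 1 - (pv 1).+1%:Z.
have [rt0 nt0] := pvP 1; rewrite -/t0 in rt0 nt0.
pose tp := fix tp n : int :=
  if n is n'.+1 then tp n' + (nx (tp n')).+1%:Z else t0.
pose tn := fix tn n : int :=
  if n is n'.+1 then tn n' - (pv (tn n')).+1%:Z else t0.
have rtp n : regen a u (tp n) by case: n => //= n; exact: (nxP _).1.
have rtn n : regen a u (tn n) by case: n => //= n; exact: (pvP _).1.
have tp_ge n : t0 + n%:Z <= tp n by elim: n => [|n IH] /=; lia.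
have tn_le n : tn n <= t0 - n%:Z by elim: n => [|n IH] /=; lia.
(* [Negz n] is the integer -(n+1), whence the index [n.+1]. *)
exists (fun l => match l with Posz n => tp n | Negz n => tn n.+1 end); split.
- move=> i; split; last by move=> [[n|n] ->]; apply/regenerationP.
  move=> /regenerationP ri; have [it0|t0i] := ltP i t0.
    (* By minimality an event before [t0] lies between two successive terms of [tn], and it can only
       be the lower one. *)
    have ex : exists n : nat, tn n <= i.
      by exists (absz (t0 - i)%R); have := tn_le (absz (t0 - i)%R); lia.
    case: (ex_minnP ex) => -[|n] ni min; first by move: ni => /=; lia.
    exists (Negz n); apply/eqP; rewrite eq_le ni andbT leNgt; apply/negP => ti.
    have : ~ (tn n <= i) by move=> /min; rewrite ltnn.
    by move=> /negP; rewrite -ltNge => itn; apply: (pvP (tn n)).2 ri.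
  have ex : exists n : nat, i < tp n.
    by exists (absz (i - t0)%R).+1; have := tp_ge (absz (i - t0)%R).+1; lia.
  case: (ex_minnP ex) => -[|n] ni min; first by move: ni => /=; lia.
  exists (Posz n); apply/eqP; rewrite eq_le andbC.
  have : ~ (i < tp n) by move=> /min; rewrite ltnn.
  move=> /negP; rewrite -leNgt => tni; rewrite tni/= leNgt; apply/negP => ti.
  by apply: (nxP (tp n)).2 ri.
- move=> [n|[|n]].
  + by rewrite (_ : Posz n + 1 = Posz n.+1)/=; lia.
  + by rewrite (_ : Negz 0 + 1 = Posz 0)/=; lia.
  + by rewrite (_ : Negz n.+1 + 1 = Negz n)/=; lia.
- rewrite /= -/t0; have [r1 _] := nxP t0; apply/andP; split; first by rewrite /t0; lia.
  by rewrite ltNge; apply/negP => le0; apply: nt0 r1; lia.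
Qed.

(** Strictly increasing integer times move by at least 1 at each step, hence are unbounded on both
    sides. *)
Lemma event_times_recurrent u t : is_event_times (regeneration a u) t ->
  recurrent u.
Proof.
move=> [ht lt_t t01].
have t_ge (n : nat) : t 0 + n%:Z <= t n%:Z.
  elim: n => [|n IH]; first by rewrite addr0.
  by have := lt_t n%:Z; rewrite (_ : n%:Z + 1 = n.+1%:Z); lia.
have t_le (n : nat) : t (- n%:Z) <= t 0 - n%:Z.
  elim: n => [|n IH]; first by rewrite oppr0 subr0.
  by have := lt_t (- n.+1%:Z); rewrite (_ : - n.+1%:Z + 1 = - n%:Z); lia.
have rt l : regen a u (t l) by apply/regenerationP/ht; exists l.
split=> m; last first.
  exists (t (- (absz (m - t 0)%R)%:Z)); last exact: rt.
  by apply: le_trans (t_le _) _; lia.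
exists (t ((absz (m - t 0)%R)%:Z)); last exact: rt.
by apply: le_trans (t_ge _); lia.
Qed.

Lemma event_timesP u : recurrent u ->
  is_event_times (regeneration a u) (event_times (regeneration a u)).
Proof.
by move=> /recurrent_event_times[t ht]; rewrite /event_times; apply: xgetPex; exists t.
Qed.

Lemma no_regen_between (t : int -> int) u l k :
  is_event_times (regeneration a u) t ->
  t l < k -> k < t (l + 1) -> ~ regen a u k.
Proof.
move=> [ht lt_t _] lk kl /regenerationP/ht[i ki].
have mono i' (n : nat) : t i' + n%:Z <= t (i' + n%:Z).
  elim: n => [|n IH]; first by rewrite !addr0.
  by have := lt_t (i' + n%:Z); rewrite (_ : i' + n%:Z + 1 = i' + n.+1%:Z); lia.
have [li|il] := ltP l i.
  have := mono (l + 1) (absz (i - (l + 1))%R).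
  by rewrite (_ : l + 1 + (absz (i - (l + 1))%R)%:Z = i); lia.
by have := mono i (absz (l - i)%R); rewrite (_ : i + (absz (l - i)%R)%:Z = l); lia.
Qed.

Section nth_block.
Context (G : countType) (psi : trajectory R -> int -> G).
Hypothesis measurable_psi : forall n g, measurable [set u | psi u n = g].

(** An excursion forbids any inner point to survive up to its end. This makes the decompositions
    over the endpoints of a block disjoint. *)
Lemma excursion_lt u j k k' B : (j < k)%R -> (k < k')%R ->
  excursion a psi u j k' B -> below a u k k' -> False.
Proof. by move=> jk kk' [_ h _]; exact: h. Qed.

(** Given an event at [j], surviving up to [j] and being an event are the same for earlier times, by
    [below_regen]. *)
Lemma excursion_regen u i j B : i < j -> regen a u j ->
  excursion a psi u i j B <-> [/\ regen a u i,
    forall k, i < k -> k < j -> ~ regen a u k & B (segment psi u i j)].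
Proof.
move=> ij rj; split=> -[h1 h2 h3]; split=> //.
- by apply: below_regen h1 rj => //; exact: ltW.
- by move=> k ik kj rk; apply: (h2 k ik kj); exact: regen_below.
- exact: regen_below.
- by move=> k ik kj bk; apply: (h2 k ik kj); apply: below_regen bk rj => //; exact: ltW.
Qed.

(** For [psi := Phi P g0] this unfolds to [block P g0 u l]. *)
Definition nth_block u l : seq G := let t := event_times (regeneration a u) in
  segment psi u (t l) (t (l + 1)).

Section windows.
Variable A : int -> set (seq G).
Local Notation T u := (event_times (regeneration a u)).

Let regenT u l : recurrent u -> regen a u (T u l).
Proof. by move=> /event_timesP[ht _ _]; apply/regenerationP/ht; exists l. Qed.

Let ltT u l : recurrent u -> T u l < T u (l + 1).
Proof. by move=> /event_timesP[]. Qed.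

(** As [T u l] is an event, an excursion ending there can only start at [T u (l - 1)]; the induction
    then proceeds leftwards. *)
Lemma past_blocksP u r l : recurrent u -> past_blocks a psi A r l (T u l) u <->
  forall m, (m < r)%N -> A (l - m.+1%:Z)%R (nth_block u (l - m.+1%:Z)).
Proof.
move=> ru; elim: r l => [//|r IH] l /=.
have lt1 := ltT (l - 1) ru; rewrite subrK in lt1.
have no1 k := @no_regen_between (T u) u (l - 1) k (event_timesP ru).
rewrite subrK in no1.
split.
  move=> [n [/(excursion_regen _ _ (regenT ru))[|rn nrn An pn]]]; first lia.
  (* In either strict order, one of these two events would lie strictly between consecutive
     events. *)
  have eT : T u l - n.+1%:Z = T u (l - 1).
    have [lt|lt|//] := ltgtP (T u l - n.+1%:Z) (T u (l - 1)).
      by case: (nrn _ lt lt1); exact: regenT.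
    by case: (no1 _ lt) => //; lia.
  move: pn; rewrite eT => /IH pn [_|m mr].
    by rewrite /nth_block subrK -eT.
  by rewrite (_ : l - m.+2%:Z = l - 1 - m.+1%:Z); [exact: pn|lia].
move=> h; exists (absz (T u l - T u (l - 1) - 1)%R).
rewrite (_ : T u l - _ = T u (l - 1)); last lia.
split.
  apply/(excursion_regen _ lt1 (regenT ru)); split.
  - exact: regenT.
  - by move=> k k1 k2; exact: no1.
  - by have := h 0%N isT; rewrite /nth_block subrK.
apply/IH => m mr; have := h m.+1 mr.
by rewrite (_ : l - m.+2%:Z = l - 1 - m.+1%:Z)//; lia.
Qed.

Lemma future_blocksP u r l : recurrent u ->
  future_blocks a psi A r l (T u l) u <->
  forall m, (m < r)%N -> A (l + m%:Z) (nth_block u (l + m%:Z)).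
Proof.
move=> ru; elim: r l => [|r IH] l /=; first by split=> // _; exact: regenT.
have lt1 := ltT l ru.
have no1 k := @no_regen_between (T u) u l k (event_timesP ru).
split.
  move=> [n [en pn]]; have rn := future_blocks_regen a_nd pn.
  move: en => /(excursion_regen _ _ rn)[|_ nrn An]; first lia.
  have eT : T u l + n.+1%:Z = T u (l + 1).
    have [lt|lt|//] := ltgtP (T u l + n.+1%:Z) (T u (l + 1)).
      by case: (no1 _ _ lt rn); lia.
    by case: (nrn _ lt1 lt); exact: regenT.
  move: pn; rewrite eT => /IH pn [_|m mr].
    by rewrite /nth_block addr0 -eT.
  by rewrite (_ : l + m.+1%:Z = l + 1 + m%:Z); [exact: pn|lia].
move=> h; exists (absz (T u (l + 1) - T u l - 1)%R).
rewrite (_ : T u l + _ = T u (l + 1)); last lia.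
split.
  apply/(excursion_regen _ lt1 (regenT ru)); split.
  - exact: regenT.
  - by move=> k k1 k2; exact: no1.
  - by have := h 0%N isT; rewrite addr0.
apply/IH => m mr; have := h m.+1 mr.
by rewrite (_ : l + m.+1%:Z = l + 1 + m%:Z)//; lia.
Qed.

(** Blocks number -r to r around the origin, where [- n] and [1 + m] stand for T_0 <= 0 and T_1 >=
    1. The three conditions concern the disjoint ranges of coordinates before [- n], in [-n,1+m[,
    and from [1 + m] on. *)
Definition window (r : nat) u := exists n m : nat,
  [/\ past_blocks a psi A r 0 (- n%:Z) u,
      excursion a psi u (- n%:Z) (1 + m%:Z) (A 0) &
      future_blocks a psi A r 1 (1 + m%:Z) u].

(** Two events, one at most 0 and one at least 1, with no event in between can only be T_0 and T_1;
    the blocks on either side are then identified by [past_blocksP] and [future_blocksP]. *)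
Lemma windowP u r : recurrent u -> window r u <->
  forall l, - r%:Z <= l -> l <= r%:Z -> A l (nth_block u l).
Proof.
move=> ru; have lt1 := ltT 0 ru; have [_ _ /andP[T0 T1]] := event_timesP ru.
have no1 k := @no_regen_between (T u) u 0 k (event_timesP ru).
rewrite add0r in lt1 no1.
split.
  move=> [n [m [pn e01 fm]]]; have rm := future_blocks_regen a_nd fm.
  move: e01 => /(excursion_regen _ _ rm)[|rn nr A0]; first lia.
  have eT0 : - n%:Z = T u 0.
    have [lt|lt|//] := ltgtP (- n%:Z) (T u 0).
      by case: (nr (T u 0)) => //; [lia|exact: regenT].
    by case: (no1 _ lt) => //; lia.
  have eT1 : 1 + m%:Z = T u 1.
    have [lt|lt|//] := ltgtP (1 + m%:Z) (T u 1).
      by case: (no1 (1 + m%:Z)) => //; lia.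
    by case: (nr (T u 1)) => //; [lia|exact: regenT].
  rewrite eT0 in pn; rewrite eT1 in fm.
  move: pn fm => /past_blocksP-/(_ ru) pn /future_blocksP-/(_ ru) fm l rl lr.
  have [l0|l0|->] := ltgtP l 0.
  - by have := pn (absz (l + 1)%R); rewrite (_ : 0 - (absz (l + 1)%R).+1%:Z = l); [apply|]; lia.
  - by have := fm (absz (l - 1)%R); rewrite (_ : 1 + (absz (l - 1)%R)%:Z = l); [apply|]; lia.
  - by rewrite /nth_block add0r -eT0 -eT1.
move=> h; exists (absz (T u 0)%R), (absz (T u 1 - 1)%R).
rewrite (_ : - (absz (T u 0)%R)%:Z = T u 0); last lia.
rewrite (_ : 1 + (absz (T u 1 - 1)%R)%:Z = T u 1); last lia.
split.
- by apply/past_blocksP => // m mr; apply: h; lia.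
- apply/(excursion_regen _ lt1 (regenT ru)); split; first exact: regenT.
    by move=> k k1 k2; exact: no1.
  by have := h 0; rewrite /nth_block add0r; apply; lia.
- by apply/future_blocksP => // m mr; apply: h; lia.
Qed.

Lemma measurable_window r : measurable [set u | window r u].
Proof.
apply: measurable_ex => n; apply: measurable_ex => m.
rewrite (_ : mkset _ = [set u | past_blocks a psi A r 0 (- n%:Z) u /\
    (excursion a psi u (- n%:Z) (1 + m%:Z) (A 0) /\
     future_blocks a psi A r 1 (1 + m%:Z) u)]); last first.
  by apply/seteqP; split=> u /= => [[]|[h1 [h2 h3]]].
apply: measurable_conj; first exact: measurable_past_blocks.
apply: measurable_conj; first exact: measurable_excursion.
exact: measurable_future_blocks.
Qed.

End windows.

(* Without an enumeration of the events, [event_times] is the identity. *)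
Lemma nth_block_not_recurrent u l : ~ recurrent u ->
  nth_block u l = [:: psi u l].
Proof.
move=> nr; rewrite /nth_block /event_times; case: xgetP => [t _ ht|_].
  by case: nr; exact: event_times_recurrent ht.
rewrite /segment (_ : (absz (id (l + 1) - id l)%R) = 1%N)/= ?addr0//; lia.
Qed.

Lemma measurable_nth_block l B : measurable [set u | B (nth_block u l)].
Proof.
(* Only block [l] is constrained; the window of radius |l| is wide enough to contain it. *)
pose A i := if i == l then B else setT.
rewrite (_ : mkset _ = [set u | (recurrent u /\ window A (absz l) u) \/
    (~ recurrent u /\ B [:: psi u l])]); last first.
  apply/seteqP; split=> u /=.
    have [ru Bu|nr] := pselect (recurrent u).
      left; split=> //; apply/windowP => // i _ _.
      by rewrite /A; case: eqP => // ->.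
    by rewrite nth_block_not_recurrent//; right.
  move=> [[ru /(windowP _ _ ru) h]|[nr]]; last by rewrite nth_block_not_recurrent.
  by have := h l; rewrite /A eqxx; apply; lia.
apply: measurable_disj; apply: measurable_conj.
- exact: measurable_recurrent.
- exact: measurable_window.
- by apply: measurable_not; exact: measurable_recurrent.
rewrite (_ : mkset _ = [set u | exists g, B [:: g] /\ psi u l = g]); last first.
  apply/seteqP; split=> u /=; first by exists (psi u l).
  by move=> [g [Bg ->]].
by apply: measurable_ex => g; apply: measurable_conj => //; exact: measurable_const.
Qed.

End nth_block.
End event_times.

(** * The house-of-cards chain *)

Lemma nneseries_finite (R : realType) (f : nat -> \bar R) N :
  (forall n, (0 <= f n)%E) -> (forall n, (N <= n)%N -> f n = 0%E) ->
  (\sum_(n <oo) f n = \sum_(n < N) f n)%E.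
Proof.
move=> f0 fN; rewrite (nneseries_split 0 N)// add0n big_mkord eseries0 ?adde0//.
by move=> n Nn _; exact: fN.
Qed.

Section house_of_cards.
Context (R : realType) (a : nat -> R).
Hypothesis a_ge0 : forall n, 0 <= a n.
Hypothesis a_le1 : forall n, a n <= 1.
Local Notation law := (chain_law (house a) 0).
Local Notation h n := (\prod_(k < n) a k).

Lemma house_ge0 x y : 0 <= house a x y.
Proof. by rewrite /house; case: ifP => // _; case: ifP => //; rewrite subr_ge0. Qed.

Lemma house_law_ge0 n y : (0 <= law n y)%E.
Proof.
elim: n y => [|n IH] y /=; first by rewrite lee_fin.
by apply: nneseries_ge0 => x _ _; rewrite mule_ge0// lee_fin house_ge0.
Qed.

Lemma house_law_rec n y :
  law n.+1 y = (\sum_(x <oo) law n x * (house a x y)%:E)%E.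
Proof. by []. Qed.

(** A nonzero state is entered only from the state just below it. *)
Lemma house_law_succ n y : law n.+1 y.+1 = (law n y * (a y)%:E)%E.
Proof.
rewrite house_law_rec (@nneseries_finite _ _ y.+1).
- rewrite big_ord_recr/= big1 ?add0e; first by rewrite /house eqxx.
  by move=> i _; rewrite /house eqSS gtn_eqF// mule0.
- by move=> x; rewrite mule_ge0 ?house_law_ge0// lee_fin house_ge0.
- by move=> x yx; rewrite /house eqSS ltn_eqF// mule0.
Qed.

Lemma house_law_big n y : (n < y)%N -> law n y = 0%E.
Proof.
elim: n y => [|n IH] [|y] // ny.
by rewrite house_law_succ IH// mul0e.
Qed.

(** The chain is at [y] at time [n] exactly when it was at 0 at time [n - y] and has climbed ever
    since. *)
Lemma house_law_rho n y : (y <= n)%N -> law n y = (rho a (n - y) * (h y)%:E)%E.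
Proof.
elim: n y => [|n IH] [|y] // yn; rewrite ?big_ord0 ?mule1 ?subn0//.
by rewrite house_law_succ IH// subSS big_ord_recr/= EFinM muleA.
Qed.

(** After [n] steps the chain lives on {0,...,n}, and the two transitions out of each state have
    total probability 1. *)
Lemma house_law_total n : (\sum_(y < n.+1) law n y = 1)%E.
Proof.
elim: n => [|n IH]; first by rewrite big_ord1.
rewrite big_ord_recl house_law_rec (@nneseries_finite _ _ n.+1).
- under [X in (_ + X)%E]eq_bigr do rewrite lift0 house_law_succ.
  rewrite -big_split/= -[RHS]IH; apply: eq_bigr => x _.
  rewrite -ge0_muleDr ?lee_fin ?house_ge0//.
  by rewrite -EFinD /house/= subrK mule1.
- by move=> x; rewrite mule_ge0 ?house_law_ge0// lee_fin house_ge0.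
- by move=> x nx; rewrite house_law_big// mul0e.
Qed.

Lemma rho_ge0 n : (0 <= rho a n)%E.
Proof. exact: house_law_ge0. Qed.

(** The total mass at time [n], sorted by the time [k] elapsed since the last visit to 0. *)
Lemma rho_renewal n : (\sum_(k < n.+1) (h k)%:E * rho a (n - k) = 1)%E.
Proof.
rewrite -[RHS](house_law_total n); apply: eq_bigr => k _.
by rewrite house_law_rho 1?muleC// -ltnS.
Qed.

Lemma rho_fin_num n : rho a n \is a fin_num.
Proof.
rewrite ge0_fin_numE ?rho_ge0//; apply: le_lt_trans (ltry 1).
rewrite -(rho_renewal n) big_ord_recl big_ord0 mul1e subn0 leeDl//.
apply: sume_ge0 => k _; rewrite mule_ge0 ?rho_ge0// lee_fin.
by apply: prodr_ge0.
Qed.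

(** The system is triangular with diagonal coefficient [h 0 = 1], so the difference of two solutions
    vanishes by strong induction. *)
Lemma rho_unique (b : \bar R) (f : nat -> \bar R) : b \is a fin_num ->
  (forall n, f n \is a fin_num) ->
  (forall n, \sum_(k < n.+1) (h k)%:E * f (n - k)%N = b)%E ->
  forall n, (f n = b * rho a n)%E.
Proof.
move=> finb finf fb n; pose d n := fine (f n) - fine b * fine (rho a n).
have dE m : \sum_(k < m.+1) h k * d (m - k)%N = 0.
  have /(congr1 fine) := fb m; have /(congr1 fine) := rho_renewal m.
  under eq_bigr do rewrite -(fineK (rho_fin_num _)) -EFinM.
  rewrite sumEFin/= => rho1.
  under eq_bigr do rewrite -(fineK (finf _)) -EFinM.
  rewrite sumEFin/= => f1.
  under eq_bigr do rewrite mulrBr mulrCA.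
  by rewrite sumrB f1 -mulr_sumr rho1 mulr1 subrr.
suff d0 : d n = 0.
  rewrite -(fineK finb) -(fineK (finf n)) -(fineK (rho_fin_num n)) -EFinM.
  by congr (_%:E); apply/eqP; rewrite -subr_eq0; exact/eqP.
elim/ltn_ind: n => n IH.
have := dE n; rewrite big_ord_recl big_ord0 mul1r subn0 big1 ?addr0//.
by move=> i _; rewrite lift0 IH ?mulr0//; have := ltn_ord i; lia.
Qed.

End house_of_cards.

(** * Law of the regeneration events and of the blocks *)

Section regeneration_law.
Context (R : realType) (a : nat -> R).
Hypothesis a_nd : forall m n, (m <= n)%N -> a m <= a n.
Hypothesis a_ge0 : forall n, 0 <= a n.
Hypothesis a_le1 : forall n, a n <= 1.
Context (Q : probability (trajectory R) R) (lam : set R -> \bar R).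
Hypothesis iidQ : forall s (A : int -> set R), uniq s ->
  (forall i, measurable (A i)) ->
  Q (\bigcap_(i in [set` s]) [set u : trajectory R | A i (u i)]) =
  (\prod_(i <- s) lam (A i))%E.
Hypothesis lam_lt : forall n, lam [set` `]-oo, a n[%R] = (a n)%:E.
Implicit Types (u : trajectory R) (i j k : int) (F : trajectory R -> Prop).

(** Independence of the coordinates before [j] from those at [j] and later, the form in which
    independence is used below. *)
Lemma independent_at j (E F : trajectory R -> Prop) :
  measurable [set u | E u] -> measurable [set u | F u] ->
  (forall u u', (forall k, k < j -> u k = u' k) -> E u -> E u') ->
  (forall u u', (forall k, j <= k -> u k = u' k) -> F u -> F u') ->
  Q [set u | E u /\ F u] = (Q [set u | E u] * Q [set u | F u])%E.
Proof.
move=> mE mF eE eF.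
apply: (trajectory_independent iidQ (J1 := [pred k | k < j])
  (J2 := [pred k | j <= k])) => //.
by move=> i; rewrite !inE -ltNge.
Qed.

Lemma probability_shift h F : measurable [set u | F u] ->
  Q [set u | F (shift h u)] = Q [set u | F u].
Proof. by move=> mF; exact: (trajectory_stationary iidQ h mF). Qed.

Lemma probability_lt_coord k n : Q [set u | u k < a n] = (a n)%:E.
Proof.
rewrite -lam_lt; have := @iidQ [:: k] (fun=> [set` `]-oo, a n[%R]) isT.
rewrite big_seq1 => <-; last by move=> _; exact: measurable_itv.
congr (Q _); apply/seteqP; split=> u /=.
  by move=> uk i /=; rewrite inE => /eqP ->; rewrite in_itv.
by move=> /(_ k); rewrite /= inE eqxx in_itv => /(_ isT).
Qed.

Lemma probability_below0 n :
  Q [set u | below a u 0 n%:Z] = (\prod_(k < n) a k)%:E.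
Proof.
elim: n => [|n IH].
  rewrite big_ord0 (_ : mkset _ = setT) ?probability_setT//.
  by apply/seteqP; split=> // u _ k /= k0 k1; move: (le_lt_trans k0 k1); rewrite ltxx.
rewrite big_ord_recr/= EFinM -IH -(probability_lt_coord n n) -(@independent_at n).
- congr (Q _); apply/seteqP; split=> u /=.
    move=> h; split=> [k k0 kn|]; first by apply: h => //; lia.
    by have := h n; rewrite subr0; apply; lia.
  move=> [h1 h2] k k0; have [kn _|nk kn] := ltP k n%:Z; first exact: h1.
  by rewrite (_ : k = n) ?subr0//; lia.
- exact: measurable_below.
- exact: measurable_lt_coord.
- by move=> u u' e; apply: below_ext => k _; exact: e.
- by move=> u u' e /=; rewrite e.
Qed.

Definition regen_prob : \bar R := Q [set u | regen a u 0].
Local Notation b := regen_prob.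

Lemma probability_regen j : Q [set u | regen a u j] = b.
Proof.
rewrite /regen_prob -[RHS](probability_shift j); last exact: measurable_regen.
by congr (Q _); apply: eq_set => u; rewrite propeqE regen_shift add0r.
Qed.

(** Continuity from above: A_0 is the decreasing intersection of the events [below a u 0 n.+1],
    whose probabilities are the partial products of the [a k]. *)
Lemma regen_prob_gt0 : 0 < limn (fun n => \prod_(k < n.+1) a k) -> (0 < b)%E.
Proof.
move=> lim_gt0; set p := fun n => \prod_(k < n.+1) a k in lim_gt0.
apply: lt_le_trans (_ : ((limn p)%:E <= b)%E); first by rewrite lte_fin.
have p_ni : nonincreasing_seq p.
  apply/nonincreasing_seqP => n; rewrite /p [leLHS]big_ord_recr/=.
  by rewrite ler_piMr// prodr_ge0.
have cvp : cvgn p.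
  apply: nonincreasing_is_cvgn => //; exists 0 => _ [n _ <-].
  by apply: prodr_ge0.
have := @nonincreasing_cvg_mu _ _ _ Q (fun n => [set u | below a u 0 n.+1%:Z]).
have -> : \bigcap_n [set u | below a u 0 n.+1%:Z] = [set u | regen a u 0].
  apply/seteqP; split=> u /=; last by move=> h n _; exact: regen_below.
  by move=> h k k0; apply: (h `|k|%N) => //; lia.
rewrite /regen_prob => /(_ _ _ _ _)/cvg_lim <- //.
- rewrite -EFin_lim// (_ : EFin \o p =
    Q \o (fun n => [set u | below a u 0 n.+1%:Z]))//.
  by apply/funext => n /=; rewrite probability_below0.
- by rewrite ltey_eq fin_num_measure//; exact: measurable_below.
- by move=> n; exact: measurable_below.
- exact: measurable_regen.
- move=> m n mn; apply/subsetPset => u h k k0 km; apply: h => //.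
  by apply: lt_le_trans km _; lia.
Qed.

(** * Recurrence: almost surely the events are unbounded in both directions *)

Hypothesis b_gt0 : (0 < b)%E.

Lemma regen_prob_fin_num : b \is a fin_num.
Proof. by rewrite fin_num_measure//; exact: measurable_regen. Qed.

Definition no_regen_from m u := forall k, m <= k -> ~ regen a u k.

Definition no_regen_upto m u := forall k, k <= m -> ~ regen a u k.

Lemma measurable_no_regen_from m : measurable [set u | no_regen_from m u].
Proof.
apply: measurable_all => k; apply: measurable_imp; apply: measurable_not.
exact: measurable_regen.
Qed.

Lemma measurable_no_regen_upto m : measurable [set u | no_regen_upto m u].
Proof.
apply: measurable_all => k; apply: measurable_imp; apply: measurable_not.
exact: measurable_regen.
Qed.

Lemma probability_no_regen_from m : Q [set u | no_regen_from m u] = 0.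
Proof.
pose q := Q [set u | no_regen_from 0 u].
have qE j : Q [set u | no_regen_from j u] = q.
  rewrite /q -[RHS](probability_shift j); last exact: measurable_no_regen_from.
  congr (Q _); apply: eq_set => u; rewrite propeqE /no_regen_from.
  split=> h k jk; first by rewrite regen_shift; apply: h; lia.
  by have := h (k - j); rewrite regen_shift subrK; apply; lia.
rewrite qE.
(* [k] is the first coordinate that violates the conditions for an event at 0. These cases partition
   the complement of A_0. *)
pose fails (k : nat) u := below a u 0 k%:Z /\ ~ (u k%:Z < a k).
have mfails n : measurable [set u | fails n u].
  apply: measurable_conj; first exact: measurable_below.
  by apply: measurable_not; exact: measurable_lt_coord.
have dfails (i j : nat) u : (i < j)%N -> fails i u -> fails j u -> False.
  by move=> ij [_ h1] [h2 _]; apply: h1; have := h2 i; rewrite subr0; apply; lia.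
have failsP : [set u | exists n, fails n u] = [set u | ~ regen a u 0].
  apply/seteqP; split=> u /=.
    by move=> [k [_ h1]] h2; apply: h1; have := h2 k; rewrite subr0; apply.
  move=> nr; have ex : exists k : nat, ~~ `[< u k%:Z < a k >].
    apply: contrapT => h; apply: nr => k k0; apply: contrapT => uk; apply: h.
    exists `|k|%N; apply/asboolP; rewrite (_ : `|k|%N%:Z = k); last lia.
    by rewrite subr0 in uk.
  case: (ex_minnP ex) => n /asboolP un min; exists n; split=> // k k0 kn.
  apply: contrapT => uk; have := min `|k|%N; rewrite leqNgt.
  rewrite (_ : (`|k| < n)%N); last lia.
  suff -> : ~~ `[< u `|k|%N%:Z < a `|k| >] by move=> /(_ isT).
  by apply/asboolP; rewrite (_ : `|k|%N%:Z = k) ?subr0 in uk *; lia.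
(* Without events from 0 on, the candidate 0 fails at some [k], which involves the coordinates up to
   [k]; the absence of events from [k + 1] on is independent of this and again has probability
   [q]. *)
have ler_q : (q <= (1 - b) * q)%E.
  have -> : (1 - b)%E = Q [set u | exists n, fails n u].
    by rewrite failsP -probability_setC//; exact: measurable_regen.
  rewrite probability_ex// -nneseriesMr//; last first.
    by rewrite fin_num_measure//; exact: measurable_no_regen_from.
  rewrite (eq_eseriesr (g := fun k : nat =>
      Q [set u | fails k u /\ no_regen_from k.+1%:Z u])); last first.
    move=> k _; rewrite -(qE k.+1%:Z) -(@independent_at k.+1%:Z)//.
    - exact: measurable_no_regen_from.
    - move=> u u' e [h1 h2]; split; last by rewrite -e//; lia.
      by apply: below_ext h1 => l _ lk; apply: e; lia.
    - move=> u u' e h l kl; have := h l kl; apply: contra_not.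
      by apply: regen_ext => i li; rewrite e//; lia.
  rewrite -probability_ex; first last.
  - by move=> i j u ij [h1 _] [h2 _]; exact: dfails h1 h2.
  - move=> n; apply: measurable_conj => //; exact: measurable_no_regen_from.
  apply: le_measure; rewrite ?inE.
  - exact: measurable_no_regen_from.
  - apply: measurable_ex => k; apply: measurable_conj => //.
    exact: measurable_no_regen_from.
  - move=> u /= h; have : (mkset (fun u => ~ regen a u 0)) u by apply: h.
    rewrite -failsP => -[k fk]; exists k; split=> // l kl; apply: h; lia.
have qfin : q \is a fin_num.
  by rewrite fin_num_measure//; exact: measurable_no_regen_from.
have q0 : (0 <= q)%E by exact: measure_ge0.
move: ler_q b_gt0 q0; rewrite -(fineK qfin) -(fineK regen_prob_fin_num).
rewrite -EFinB -EFinM !lee_fin lte_fin => h1 h2 h3; congr (_%:E).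
(* The inequality reads b q <= 0, with b > 0 and q >= 0. *)
nra.
Qed.

(** The cases of a first event at 0, 1, 2, ... are disjoint and, by shift invariance, equally
    likely; so N p <= 1 for every N. *)
Lemma probability_first_regen m :
  Q [set u | regen a u m /\ no_regen_upto (m - 1) u] = 0.
Proof.
pose first j u := regen a u j /\ no_regen_upto (j - 1) u.
have mfirst j : measurable [set u | first j u].
  by apply: measurable_conj;
    [exact: measurable_regen|exact: measurable_no_regen_upto].
pose p := Q [set u | first 0 u].
have pE j : Q [set u | first j u] = p.
  rewrite /p -[RHS](probability_shift j)//.
  congr (Q _); apply: eq_set => u.
  rewrite propeqE /first regen_shift add0r /no_regen_upto.
  split=> -[h1 h2]; split=> // k jk; first by rewrite regen_shift; apply: h2; lia.
  by have := h2 (k - j); rewrite regen_shift subrK; apply; lia.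
rewrite -/(first m _) pE.
have : (\sum_(n <oo) Q [set u | first n%:Z u] <= 1)%E.
  rewrite -probability_ex//; first by apply: probability_le1; exact: measurable_ex.
  by move=> i j u ij [h1 _] [_ h2]; apply: h2 h1; lia.
have pfin : p \is a fin_num by rewrite fin_num_measure.
have p0 : (0 <= p)%E by exact: measure_ge0.
move=> sum_le1; apply/eqP; rewrite eq_le p0 andbT leNgt; apply/negP => p_gt0.
have Nle N : N%:R * fine p <= 1.
  rewrite -lee_fin; apply: le_trans sum_le1.
  apply: le_trans (nneseries_lim_ge N _) => //.
  under eq_bigr do rewrite pE -(fineK pfin).
  by rewrite sumEFin sumr_const_nat subn0 mulr_natl lexx.
have fp : 0 < fine p by rewrite fine_gt0// p_gt0 ltey_eq pfin.
(* An integer exceeding 1/p contradicts the bound. *)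
have := Nle (Num.truncn (fine p)^-1).+1.
apply/negP; rewrite -ltNge -ltr_pdivrMr// mul1r.
by rewrite truncnS_gt.
Qed.

(** Either some event follows [m], and then there is a first event overall, or none does; both cases
    are null. *)
Lemma probability_no_regen_upto m : Q [set u | no_regen_upto m u] = 0.
Proof.
apply/eqP; rewrite eq_le measure_ge0 andbT.
have := @le_measure _ _ _ Q [set u | no_regen_upto m u]
  [set u | (exists n : nat, regen a u (m + n.+1%:Z) /\
     no_regen_upto (m + n.+1%:Z - 1) u) \/ no_regen_from (m + 1) u].
have mE : measurable [set u | exists n : nat, regen a u (m + n.+1%:Z) /\
     no_regen_upto (m + n.+1%:Z - 1) u].
  apply: measurable_ex => n; apply: measurable_conj.
    exact: measurable_regen.
  exact: measurable_no_regen_upto.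
move=> /(_ _ _ _)/le_trans; apply.
- by rewrite inE; exact: measurable_no_regen_upto.
- by rewrite inE; apply: measurable_disj => //; exact: measurable_no_regen_from.
- move=> u /= h; have [ex|nex] := pselect (exists n : nat, `[< regen a u (m + n.+1%:Z) >]).
    left; case: (ex_minnP ex) => n /asboolP rn min; exists n; split=> // k kn rk.
    have [km|mk] := leP k m; first exact: h km rk.
    have := min (absz (k - m - 1)%R); rewrite leqNgt.
    rewrite (_ : (absz (k - m - 1)%R < n)%N); last lia.
    rewrite (_ : m + (absz (k - m - 1)%R).+1%:Z = k); last lia.
    by move=> hf; apply/negP: isT; apply: hf; apply/asboolP.
  right=> k mk rk; apply: nex; exists (absz (k - m - 1)%R); apply/asboolP.
  by rewrite (_ : m + (absz (k - m - 1)%R).+1%:Z = k)//; lia.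
- have -> : [set u | (exists n : nat, regen a u (m + n.+1%:Z) /\
     no_regen_upto (m + n.+1%:Z - 1) u) \/ no_regen_from (m + 1) u] =
     [set u | exists n : nat, regen a u (m + n.+1%:Z) /\
     no_regen_upto (m + n.+1%:Z - 1) u] `|` [set u | no_regen_from (m + 1) u].
    by [].
  apply: le_trans (measureU2 Q mE (measurable_no_regen_from (m + 1))) _.
  rewrite [X in (_ + X <= _)%E](_ : _ = 0%E); last first.
    exact: probability_no_regen_from.
  rewrite adde0 [leLHS](_ : _ = Q [set u | exists n : nat,
    regen a u (m + n.+1%:Z) /\ no_regen_upto (m + n.+1%:Z - 1) u])//.
  rewrite probability_ex.
  + by rewrite eseries0// => n _ _; exact: probability_first_regen.
  + move=> n; apply: measurable_conj; first exact: measurable_regen.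
    exact: measurable_no_regen_upto.
  + by move=> i j u ij [h1 _] [_ h2]; apply: h2 h1; lia.
Qed.

Lemma recurrent_ae : Q.-negligible [set u | ~ recurrent a u].
Proof.
apply: (negligibleS (A := \bigcup_(n : nat) [set u | no_regen_from n%:Z u] `|`
    \bigcup_(n : nat) [set u | no_regen_upto (- n%:Z) u])).
  move=> u /= h; apply: contrapT => /not_orP[h1 h2]; apply: h; split=> m.
    apply: contrapT => h; apply: h1; exists `|m|%N => //= k mk rk; apply: h.
    by exists k => //; lia.
  apply: contrapT => h; apply: h2; exists `|m|%N => //= k mk rk; apply: h.
  by exists k => //; lia.
apply: negligibleU; apply: negligible_bigcup => n.
  apply/negligibleP; first exact: measurable_no_regen_from.
  exact: probability_no_regen_from.
apply/negligibleP; first exact: measurable_no_regen_upto.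
exact: probability_no_regen_upto.
Qed.

(** Since non-recurrent trajectories are negligible, identities between events need checking only
    where the enumeration exists. *)
Lemma eq_probability_recurrent E F : measurable [set u | E u] ->
  measurable [set u | F u] -> (forall u, recurrent a u -> E u <-> F u) ->
  Q [set u | E u] = Q [set u | F u].
Proof.
move=> mE mF EF.
have restrict E' : measurable [set u | E' u] ->
    Q [set u | E' u] = Q [set u | E' u /\ recurrent a u].
  move=> mE'; rewrite (measureDI Q mE' (measurable_recurrent a)).
  rewrite [X in (X + _)%E](_ : _ = 0%E) ?add0e//.
  apply: measure_negligible; first exact: measurableD (measurable_recurrent a).
  by apply: negligibleS recurrent_ae => u [].
rewrite (restrict E)// (restrict F)//; congr (Q _).
by apply/seteqP; split=> u /= [h ru]; split=> //; exact/EF.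
Qed.

(** * Joint law of the blocks, and law of their lengths *)

Section blocks_law.
Context (G : countType) (psi : trajectory R -> int -> G).
Hypothesis measurable_psi : forall n g, measurable [set u | psi u n = g].
Hypothesis psi_shift : forall h u n, psi (shift h u) n = psi u (n + h).
Hypothesis psi_local : forall u u' i n, i <= n -> below a u i (n + 1) ->
  (forall k, i <= k <= n -> u k = u' k) -> psi u n = psi u' n.

(** Given A_0, this is the probability that the next event is at [n + 1] with a block in [B]: the
    factor P(A_{n+1}) cancels P(A_0). Accordingly [block_law] is the law of the block starting at a
    given event. *)
Definition excursion_law (B : set (seq G)) (n : nat) : \bar R :=
  Q [set u | excursion a psi u 0 n.+1%:Z B].

Definition block_law (B : set (seq G)) : \bar R :=
  (\sum_(n <oo) excursion_law B n)%E.

Lemma probability_excursion j k (n : nat) B : k = j + n.+1%:Z ->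
  Q [set u | excursion a psi u j k B] = excursion_law B n.
Proof.
move=> ->; rewrite /excursion_law -[RHS](probability_shift j).
  by congr (Q _); apply: eq_set => u; rewrite propeqE excursion_shift// add0r addrC.
exact: measurable_excursion.
Qed.

Lemma excursion_law_ge0 B n : (0 <= excursion_law B n)%E.
Proof. exact: measure_ge0. Qed.

(** Induction on [r], summing over the length of the last block and splitting at its start. The
    probability of the remaining blocks does not depend on where they end, so it factors out of the
    sum. *)
Lemma probability_past_blocks A r l j :
  Q [set u | past_blocks a psi A r l j u] =
  (\prod_(m < r) block_law (A (l - m.+1%:Z)%R))%E.
Proof.
elim: r l j => [|r IH] l j.
  by rewrite big_ord0 /= (_ : mkset _ = setT) ?probability_setT//; apply/seteqP.
rewrite big_ord_recl /= probability_ex; first last.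
- move=> m n u mn [[h1 _ _] _] [h2 _]; apply: excursion_lt h2 h1; lia.
- move=> n; apply: measurable_conj; first exact: measurable_excursion.
  exact: measurable_past_blocks.
under eq_bigr => m _.
  rewrite /bump leq0n add1n (_ : (l - m.+2%:Z = l - 1 - m.+1%:Z)%R); last lia.
  over.
rewrite -nneseriesMr.
- apply: eq_eseriesr => n _.
  rewrite -(IH _ (j - n.+1%:Z)) -(@probability_excursion (j - n.+1%:Z) j); last lia.
  rewrite muleC -(@independent_at (j - n.+1%:Z)).
  + by congr (Q _); apply/seteqP; split=> u /= [].
  + exact: measurable_past_blocks.
  + exact: measurable_excursion.
  + by move=> u u' e; exact: past_blocks_ext.
  + by move=> u u' e; apply: excursion_ext => // [|k jk _]; [lia|exact: e].
- by move=> n; exact: excursion_law_ge0.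
- by rewrite -(IH _ 0) fin_num_measure//; exact: measurable_past_blocks.
Qed.

(** The mirror image, splitting at the end of the first block; the event that closes the chain
    contributes the factor [b]. *)
Lemma probability_future_blocks A r l j :
  Q [set u | future_blocks a psi A r l j u] =
  ((\prod_(m < r) block_law (A (l + m%:Z)%R)) * b)%E.
Proof.
elim: r l j => [|r IH] l j.
  by rewrite big_ord0 mul1e; exact: probability_regen.
rewrite big_ord_recl /= probability_ex; first last.
- move=> m n u mn [h1 /(future_blocks_regen a_nd) rm] [h2 rn].
  apply: (excursion_lt (k := j + m.+1%:Z)) h2 _; [lia|lia|].
  exact: regen_below.
- move=> n; apply: measurable_conj; first exact: measurable_excursion.
  exact: measurable_future_blocks.
under eq_bigr => m _.
  rewrite /bump leq0n add1n (_ : (l + m.+1%:Z = l + 1 + m%:Z)%R); last lia.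
  over.
rewrite -muleA -nneseriesMr.
- apply: eq_eseriesr => n _; rewrite addr0.
  rewrite -(IH _ (j + n.+1%:Z)) -(@probability_excursion j (j + n.+1%:Z))//.
  rewrite -(@independent_at (j + n.+1%:Z)).
  + by congr (Q _); apply/seteqP; split=> u /= [].
  + exact: measurable_excursion.
  + exact: measurable_future_blocks.
  + by move=> u u' e; apply: excursion_ext => // [|k _ kj]; [lia|exact: e].
  + by move=> u u' e; exact: future_blocks_ext.
- by move=> n; exact: excursion_law_ge0.
- by rewrite -(IH _ 0) fin_num_measure//; exact: measurable_future_blocks.
Qed.

Definition isolated (n : nat) u := regen a u 0 /\
  forall k, 0 < k -> k <= n%:Z -> ~ regen a u k.

Lemma measurable_isolated n : measurable [set u | isolated n u].
Proof.
apply: measurable_conj; first exact: measurable_regen.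
apply: measurable_all => k; do 2 apply: measurable_imp; apply: measurable_not.
exact: measurable_regen.
Qed.

(** A single future block from 0 is longer than [n] when no event falls in ]0,n]. *)
Lemma block_law_size n :
  (block_law [set s | (n < size s)%N] * b)%E = Q [set u | isolated n u].
Proof.
have := probability_future_blocks (fun=> [set s | (n < size s)%N]) 1 0 0.
rewrite big_ord1 => <-; apply: eq_probability_recurrent.
- exact: measurable_future_blocks.
- exact: measurable_isolated.
move=> u ru; split=> /=.
  move=> [m [h rm]]; move: h => /(excursion_regen a_nd _ _ _ rm)[|r0 nr /=]; first lia.
  rewrite size_map size_iota => nm; split=> // k k0 kn; apply: nr => //; lia.
move=> [r0 nr]; have [m [rm nrm]] := next_regen 0 ru.
exists m; split=> //; apply/(excursion_regen a_nd _ _ _ rm); first lia.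
split=> //=; rewrite size_map size_iota ltnNge; apply/negP => mn.
by apply: nr rm; lia.
Qed.

(** Take [n = 0] in [block_law_size]: blocks are never empty, so the identity reads
    [block_law setT * b = b], and [b] is positive and finite. *)
Lemma block_lawT : block_law setT = 1%E.
Proof.
have := block_law_size 0.
rewrite (_ : [set u | isolated 0 u] = [set u | regen a u 0]); last first.
  by apply/seteqP; split=> u /= => [[]//|r0]; split=> // k k0 k1; lia.
rewrite -/b (_ : block_law [set s | (0 < size s)%N] = block_law setT).
  have /fineK <- := regen_prob_fin_num.
  have bl0 : (0 <= block_law setT)%E.
    by apply: nneseries_ge0 => n _ _; exact: excursion_law_ge0.
  have bneq0 : fine b != 0 by rewrite gt_eqF// fine_gt0// b_gt0 ltey_eq regen_prob_fin_num.
  case: (block_law setT) bl0 => [x||] //.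
    by rewrite -EFinM => _ [] /(canRL (mulfK bneq0)); rewrite mulfV// => ->.
  by move=> _; rewrite mulyr gtr0_sg ?mul1e// lt0r bneq0 fine_ge0// ltW.
apply: eq_eseriesr => n _; congr (Q _); apply/seteqP; by split=> u [].
Qed.

(** The block from [- n] to [1 + m] has length n+m+1. Summing over its n+m+1 positions around the
    origin gives the size-biased version of [block_law], normalized by [b]. *)
Definition origin_law (B : set (seq G)) : \bar R :=
  ((\sum_(n <oo) \sum_(m <oo) excursion_law B (n + m)) * b)%E.

(** Sum over the positions [- n] and [1 + m] of T_0 and T_1; for fixed positions, cut at [1 + m] and
    at [- n]. Only the middle factor depends on the positions. *)
Lemma probability_window (A : int -> set (seq G)) r : Q [set u | window a psi A r u] =
  ((\prod_(m < r) block_law (A (0 - m.+1%:Z)%R)) *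
   (\prod_(m < r) block_law (A (1 + m%:Z)%R)) * origin_law (A 0%R))%E.
Proof.
have mE n m : measurable [set u | [/\ past_blocks a psi A r 0 (- n%:Z) u,
      excursion a psi u (- n%:Z) (1 + m%:Z) (A 0) &
      future_blocks a psi A r 1 (1 + m%:Z) u]].
  rewrite (_ : mkset _ = [set u | past_blocks a psi A r 0 (- n%:Z) u /\
    (excursion a psi u (- n%:Z) (1 + m%:Z) (A 0) /\
     future_blocks a psi A r 1 (1 + m%:Z) u)]); last first.
    by apply/seteqP; split=> u /= => [[]|[h1 [h2 h3]]].
  apply: measurable_conj; first exact: measurable_past_blocks.
  apply: measurable_conj; first exact: measurable_excursion.
  exact: measurable_future_blocks.
set p := (\prod_(m < r) _)%E; set f := (\prod_(m < r) _)%E.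
have finp : p \is a fin_num.
  rewrite /p -(probability_past_blocks A r 0 0) fin_num_measure//.
  exact: measurable_past_blocks.
have finfb : (f * b)%E \is a fin_num.
  rewrite /f -(probability_future_blocks A r 1 0) fin_num_measure//.
  exact: measurable_future_blocks.
have QE n m : Q [set u | [/\ past_blocks a psi A r 0 (- n%:Z) u,
      excursion a psi u (- n%:Z) (1 + m%:Z) (A 0) &
      future_blocks a psi A r 1 (1 + m%:Z) u]] =
    (excursion_law (A 0%R) (n + m) * (p * (f * b)))%E.
  rewrite /p /f -(probability_past_blocks A r 0 (- n%:Z)).
  rewrite -(probability_future_blocks A r 1 (1 + m%:Z)).
  rewrite -(@probability_excursion (- n%:Z) (1 + m%:Z)); last lia.
  rewrite muleCA -(@independent_at (1 + m%:Z)).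
  - rewrite -(@independent_at (- n%:Z)).
    + by congr (Q _); apply/seteqP; split=> u /= => [[]|[h1 [h2 h3]]].
    + exact: measurable_past_blocks.
    + apply: measurable_conj; first exact: measurable_excursion.
      exact: measurable_future_blocks.
    + by move=> u u' e; exact: past_blocks_ext.
    + move=> u u' e [h1 h2]; split.
        by apply: excursion_ext h1 => // [|k jk _]; [lia|exact: e].
      by apply: future_blocks_ext h2 => // k mk; apply: e; lia.
  - exact: measurable_excursion.
  - exact: measurable_future_blocks.
  - by move=> u u' e; apply: excursion_ext => // [|k _ kj]; [lia|exact: e].
  - by move=> u u' e; exact: future_blocks_ext.
rewrite /window probability_ex; first last.
- move=> n n' u nn' [m [_ e1 f1]] [m' [_ e2 f2]].
  have rn : regen a u (- n%:Z).
    apply: (below_regen a_nd (j := 1 + m%:Z)); [lia|by case: e1|].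
    exact: future_blocks_regen f1.
  by apply: (excursion_lt _ _ e2 (regen_below rn)); lia.
- by move=> n; apply: measurable_ex.
rewrite (eq_eseriesr (g := fun n =>
    (\sum_(m <oo) excursion_law (A 0%R) (n + m)) * (p * (f * b)))%E); last first.
  move=> n _; rewrite probability_ex//; last first.
    move=> m m' u mm' [_ e1 f1] [_ e2 f2].
    have := future_blocks_regen a_nd f1 => /regen_below rm.
    by apply: (excursion_lt _ _ e2 (rm _)); lia.
  rewrite -nneseriesMr.
  - by apply: eq_eseriesr => m _.
  - by move=> m; exact: excursion_law_ge0.
  - by rewrite fin_numM.
rewrite nneseriesMr.
- by rewrite /origin_law muleC -!muleA (muleC b).
- by move=> n; apply: nneseries_ge0 => m _ _; exact: excursion_law_ge0.
- by rewrite fin_numM.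
Qed.

Lemma probability_recurrent : Q [set u | recurrent a u] = 1%E.
Proof.
rewrite -(probability_setT Q) (_ : setT = [set u | True]) //.
apply: eq_probability_recurrent => //; first exact: measurable_recurrent.
exact: measurable_const.
Qed.

(** The unconstrained window of radius 0 is almost sure, which gives the total mass without
    computing the double sum. *)
Lemma origin_lawT : origin_law setT = 1%E.
Proof.
have := probability_window (fun=> setT) 0.
rewrite !big_ord0 !mul1e => <-; rewrite -probability_recurrent.
apply: eq_probability_recurrent.
- exact: measurable_window.
- exact: measurable_recurrent.
- by move=> u ru; split=> // _; apply/(windowP a_nd).
Qed.

Definition nth_law (l : int) (B : set (seq G)) : \bar R :=
  if l == 0 then origin_law B else block_law B.

Lemma nth_lawT l : nth_law l setT = 1%E.
Proof. by rewrite /nth_law origin_lawT block_lawT if_same. Qed.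

(** The listed numbers are enclosed in a symmetric window; the others receive the condition [setT],
    whose factor is 1. *)
Lemma probability_nth_blocks (s : seq int) (A : int -> set (seq G)) : uniq s ->
  Q (\bigcap_(i in [set` s]) [set u | A i (nth_block a psi u i)]) =
  (\prod_(i <- s) nth_law i (A i))%E.
Proof.
move=> us; pose r := (\max_(i <- s) absz i)%N.
pose A' i := if i \in s then A i else setT.
have sr i : i \in s -> (absz i <= r)%N by move=> si; exact: leq_bigmax_seq.
(* The numbers from -r to r, grouped like the factors of [probability_window]. *)
pose w := [seq 0 - m.+1%:Z | m <- iota 0 r] ++ 0 :: [seq 1 + m%:Z | m <- iota 0 r].
transitivity (\prod_(i <- w) nth_law i (A' i))%E.
  rewrite big_cat big_cons !big_map.
  transitivity (Q [set u | window a psi A' r u]).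
    rewrite (_ : \bigcap_(i in _) _ = [set u | forall i, i \in s ->
        A i (nth_block a psi u i)]); last by [].
    apply: eq_probability_recurrent.
    - apply: measurable_all => i; apply: measurable_imp.
      exact: measurable_nth_block.
    - exact: measurable_window.
    - move=> u ru; split=> [h|/(windowP a_nd _ _ _ ru) h i si].
        apply/(windowP a_nd) => // l _ _; rewrite /A'; case: ifPn => // ls; exact: h.
      by have := h i; rewrite /A' si; apply; have := sr i si; lia.
  have ordE (f : nat -> \bar R) :
      (\prod_(m < r) f m = \prod_(m <- iota 0 r) f m)%E.
    by rewrite -(big_mkord xpredT f) /index_iota subn0.
  rewrite probability_window (ordE (fun m => block_law (A' (0 - m.+1%:Z)%R))).
  rewrite (ordE (fun m => block_law (A' (1 + m%:Z)%R))).
  rewrite -muleA (muleC _ (origin_law _)).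
  congr (_ * (_ * _))%E; apply: eq_bigr => m _; rewrite /nth_law ifN//; lia.
rewrite [LHS](bigID (fun i => i \in s))/= [X in (_ * X)%E]big1 ?mule1; last first.
  by move=> i /negbTE si; rewrite /A' si nth_lawT.
rewrite -big_filter (perm_big s).
  by rewrite big_seq [RHS]big_seq; apply: eq_bigr => i si; rewrite /A' si.
apply: uniq_perm => //.
  apply: filter_uniq; rewrite cat_uniq /= !map_inj_uniq ?iota_uniq/=;
    [|by move=> m n; lia..].
  rewrite negb_or -!andbA; apply/and4P; split=> //.
  - by apply/mapP => -[m _]; lia.
  - by apply/hasPn => _ /mapP[m _ ->]; apply/mapP => -[n _]; lia.
  - by apply/mapP => -[m _]; lia.
move=> i; rewrite mem_filter; case: (boolP (i \in s)) => //= /sr ir.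
rewrite mem_cat inE; have [i0|i0|->] := ltgtP i 0.
- apply/orP; left; apply/mapP; exists (absz (i + 1)%R); last lia.
  by rewrite mem_iota; lia.
- apply/orP; right; apply/orP; right; apply/mapP; exists (absz (i - 1)%R); last lia.
  by rewrite mem_iota; lia.
- by rewrite orbT.
Qed.

Lemma probability_nth_block l B : Q [set u | B (nth_block a psi u l)] = nth_law l B.
Proof.
have := @probability_nth_blocks [:: l] (fun=> B) isT; rewrite big_seq1 => <-.
congr (Q _); apply/seteqP; split=> u /= => [Bu i /=|/(_ l)].
  by rewrite inE => /eqP ->.
by rewrite /= inE eqxx; exact.
Qed.

(** A_0 is decomposed by the last event [k] in [0,n]: survival of 0 up to [k] is independent of an
    event at [k] followed by none in ]k,n], and the latter is a shift of [isolated (n - k)]. *)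
Lemma isolated_renewal n :
  (\sum_(k < n.+1) (\prod_(i < k) a i)%:E * Q [set u | isolated (n - k) u] =
   b)%E.
Proof.
pose last_regen (k : nat) u := (k <= n)%N /\ (below a u 0 k%:Z /\
  (regen a u k%:Z /\ forall i, k%:Z < i -> i <= n%:Z -> ~ regen a u i)).
have mlate (k : nat) : measurable [set u | regen a u k%:Z /\
    forall i, k%:Z < i -> i <= n%:Z -> ~ regen a u i].
  apply: measurable_conj; first exact: measurable_regen.
  apply: measurable_all => i; do 2 apply: measurable_imp; apply: measurable_not.
  exact: measurable_regen.
have mlast m : measurable [set u | last_regen m u].
  apply: measurable_conj; first exact: measurable_const.
  by apply: measurable_conj => //; exact: measurable_below.
have -> : b = Q [set u | exists m, last_regen m u].
  congr (Q _); apply/seteqP; split=> u /=; last first.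
    by move=> [k [_ [b0 [rk _]]]]; apply: (below_regen a_nd _ b0 rk); lia.
  (* The maximum exists: 0 itself is an event, and [n] is an upper bound. *)
  move=> r0; pose p (k : nat) := (k <= n)%N && `[< regen a u k%:Z >].
  have p0 : exists m, p m by exists 0%N; apply/andP; split=> //; exact/asboolP.
  have pn m : p m -> (m <= n)%N by case/andP.
  case: (ex_maxnP p0 pn) => k /andP[kn /asboolP rk] maxk; exists k; split=> //.
  split; first exact: regen_below.
  split=> // i ki iN ri; have : p (absz i).
    apply/andP; split; first lia.
    by apply/asboolP; rewrite (_ : (absz i)%:Z = i)//; lia.
  by move=> /maxk; lia.
rewrite probability_ex//; last first.
  move=> m m' u mm' [_ [_ [_ h]]] [k'n [_ [rk' _]]].
  by apply: h rk'; lia.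
rewrite (@nneseries_finite _ _ n.+1); first last.
- move=> k nk; rewrite (_ : mkset _ = set0) ?measure0//.
  by apply/seteqP; split=> // u [kn]; lia.
- by move=> k; exact: measure_ge0.
apply: eq_bigr => k _; have kn : (k <= n)%N by rewrite -ltnS.
rewrite -probability_below0 -[X in (_ * X)%E](probability_shift k%:Z); last first.
  exact: measurable_isolated.
rewrite (_ : [set u | isolated _ _] = [set u | regen a u k%:Z /\
    forall i, k%:Z < i -> i <= n%:Z -> ~ regen a u i]).
  rewrite -(@independent_at k%:Z)//.
  - by congr (Q _); apply/seteqP; split=> u /= [].
  - exact: measurable_below.
  - by move=> u u' e; apply: below_ext => i _; exact: e.
  - move=> u u' e [h1 h2]; split; first exact: regen_ext h1.
    move=> i ki iN ri; apply: (h2 i ki iN); apply: regen_ext ri => j ij.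
    by rewrite e//; lia.
apply: eq_set => u; rewrite propeqE /isolated regen_shift add0r.
split=> -[h1 h2]; split=> // i i1 i2.
  move=> ri; apply: (h2 (i - k%:Z)); [lia|lia|].
  by rewrite regen_shift subrK.
by rewrite regen_shift; apply: h2; lia.
Qed.

(** By [isolated_renewal], [block_law_size] and [rho_unique], both sides times [b] solve the same
    triangular system. Here the strict inequality [n < size s] is paired with index [n]. *)
Lemma block_law_size_rho n : block_law [set s | (n < size s)%N] = rho a n.
Proof.
have : (block_law [set s | (n < size s)%N] * b = b * rho a n)%E.
  rewrite block_law_size; apply: (rho_unique (f := fun m =>
    Q [set u | isolated m u]) a_ge0 a_le1 regen_prob_fin_num).
    by move=> m; rewrite fin_num_measure//; exact: measurable_isolated.
  exact: isolated_renewal.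
have bneq0 : fine b != 0 by rewrite gt_eqF// fine_gt0// b_gt0 ltey_eq regen_prob_fin_num.
rewrite muleC; have := rho_fin_num a_ge0 a_le1 n.
rewrite -(fineK regen_prob_fin_num) => /fineK <-.
have bl0 : (0 <= block_law [set s | (n < size s)%N])%E.
  by apply: nneseries_ge0 => m _ _; exact: excursion_law_ge0.
case: block_law bl0 => [x||] //.
  by rewrite -!EFinM => _ [] /(mulfI bneq0) ->.
by move=> _; rewrite mulry gtr0_sg ?mul1e// lt0r bneq0 fine_ge0// measure_ge0.
Qed.

End blocks_law.

(** * Stationarity of the event process *)

Lemma measurable_regenerationE (s : seq int) (x : int -> bool) :
  measurable [set u : trajectory R | forall i, i \in s -> regeneration a u i = x i].
Proof.
apply: measurable_all => i; apply: measurable_imp.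
have -> : [set u : trajectory R | regeneration a u i = x i] =
    [set u : trajectory R | if x i then regen a u i else ~ regen a u i].
  apply: eq_set => u; rewrite propeqE; case: (x i).
    exact: regenerationP.
  by split=> [e /regenerationP|]; [rewrite e|move=> /regenerationP/negP/negbTE].
case: (x i); first exact: measurable_regen.
by apply: measurable_not; exact: measurable_regen.
Qed.

Lemma regeneration_stationary (s : seq int) (x : int -> bool) h :
  Q [set u : trajectory R | forall i, i \in s -> regeneration a u (i + h) = x i] =
  Q [set u : trajectory R | forall i, i \in s -> regeneration a u i = x i].
Proof.
rewrite -[RHS](probability_shift h); last exact: measurable_regenerationE.
congr (Q _); apply: eq_set => u; rewrite propeqE.
have rE i : regeneration a (shift h u) i = regeneration a u (i + h).
  apply/idP/idP => /regenerationP r; apply/regenerationP; first exact/regen_shift.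
  by apply/regen_shift.
by split=> H i si; move: (H i si); rewrite rE.
Qed.

End regeneration_law.

(** * The map Phi *)

Section kernel.
Context (R : realType) (G : countType) (P : G -> history G -> R) (g0 : G).
Hypothesis hP : transition_kernel P.

Let z0 : history G := fun=> g0.

Lemma past_set_ge0 w g x : [set P g (past_cat w z) | z in setT] x -> 0 <= x.
Proof. by move=> [z _ <-]; exact: kernel_ge0 hP _ _. Qed.

Lemma a_past_ge0 w g : 0 <= a_past P w g.
Proof.
apply: lb_le_inf; first by exists (P g (past_cat w z0)); exists z0.
by move=> x; exact: past_set_ge0.
Qed.

Lemma a_past_le w g z : a_past P w g <= P g (past_cat w z).
Proof.
apply: ge_inf; last by exists z.
by exists 0 => x; exact: past_set_ge0.
Qed.

Lemma past_cat_cat (w v : seq G) z :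
  past_cat (w ++ v) z = past_cat w (past_cat v z).
Proof.
apply/funext => i; rewrite /past_cat nth_cat size_cat subnDA.
have [iw|wi] := ltnP i (size w); last by rewrite [RHS]nth_default.
exact: set_nth_default.
Qed.

(** A longer fixed past leaves fewer histories in the infimum. *)
Lemma a_past_mono (w v : seq G) g : a_past P w g <= a_past P (w ++ v) g.
Proof.
apply: lb_le_inf; first by exists (P g (past_cat (w ++ v) z0)); exists z0.
by move=> _ [z _ <-]; rewrite past_cat_cat; exact: a_past_le.
Qed.

Definition mass_past (w : seq G) : \bar R :=
  (\esum_(g in [set: G]) (a_past P w g)%:E)%E.

Lemma mass_past_ge0 w : (0 <= mass_past w)%E.
Proof. by apply: esum_ge0 => g _; rewrite lee_fin a_past_ge0. Qed.

Lemma mass_past_le1 w : (mass_past w <= 1)%E.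
Proof.
rewrite -(kernel_sum1 hP (past_cat w z0)).
by apply: le_esum => g _; rewrite lee_fin a_past_le.
Qed.

Lemma mass_past_fin_num w : mass_past w \is a fin_num.
Proof.
rewrite ge0_fin_numE ?mass_past_ge0//.
exact: le_lt_trans (mass_past_le1 w) (ltry _).
Qed.

Lemma tuple_set_ge0 k x :
  [set fine (mass_past w) | w in [set: k.-tuple G]] x -> 0 <= x.
Proof. by move=> [w _ <-]; rewrite fine_ge0// mass_past_ge0. Qed.

Lemma a_ge0 k : 0 <= a_ P k.
Proof.
apply: lb_le_inf; last by move=> x; exact: tuple_set_ge0.
by exists (fine (mass_past [tuple of nseq k g0])); exists [tuple of nseq k g0].
Qed.

Lemma a_le_mass k (w : seq G) : size w = k -> a_ P k <= fine (mass_past w).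
Proof.
move=> /eqP wk; apply: ge_inf; first by exists 0 => x; exact: tuple_set_ge0.
by exists (Tuple wk).
Qed.

Lemma a_le1 k : a_ P k <= 1.
Proof.
apply: le_trans (a_le_mass (size_nseq k g0)) _.
by rewrite -lee_fin fineK ?mass_past_fin_num// mass_past_le1.
Qed.

Lemma a_nondecreasing m n : (m <= n)%N -> a_ P m <= a_ P n.
Proof.
move=> mn; apply: lb_le_inf.
  by exists (fine (mass_past [tuple of nseq n g0])); exists [tuple of nseq n g0].
move=> _ [w _ <-]; rewrite -(cat_take_drop m w).
apply: le_trans (a_le_mass (w := take m w) _) _.
  by rewrite size_takel// size_tuple.
rewrite fine_le ?mass_past_fin_num//.
by apply: le_esum => g _; rewrite lee_fin a_past_mono.
Qed.

Lemma b_past_ge0 w g : 0 <= b_past P w g.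
Proof.
case: w => [|x w] /=; first exact: a_past_ge0.
rewrite subr_ge0 -[X in _ <= a_past P X g](cat_take_drop (size w)).
exact: a_past_mono.
Qed.

Lemma b_past_le w g : b_past P w g <= a_past P w g.
Proof. by case: w => [|x w] //=; rewrite gerBl a_past_ge0. Qed.

Lemma esum_b_past_fin_num w (A : set G) :
  (\esum_(g in A) (b_past P w g)%:E)%E \is a fin_num.
Proof.
have b0 g : (0 <= (b_past P w g)%:E)%E by rewrite lee_fin b_past_ge0.
rewrite ge0_fin_numE; last exact: esum_ge0.
apply: le_lt_trans (le_lt_trans (mass_past_le1 w) (ltry 1)).
rewrite esum_mkcond; apply: le_esum => g _.
by case: ifP => _; rewrite lee_fin ?b_past_le ?a_past_ge0.
Qed.

(** With [A] the symbols enumerated before [g], the left side locates the right end of the interval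
    of [g] inside its level. *)
Lemma esum_b_past_add1 w (A B : set G) g : ~ A g -> A `<=` B -> B g ->
  fine (\esum_(h in A) (b_past P w h)%:E)%E + b_past P w g <=
  fine (\esum_(h in B) (b_past P w h)%:E)%E.
Proof.
move=> nAg AB Bg; have b0 h : (0 <= (b_past P w h)%:E)%E.
  by rewrite lee_fin b_past_ge0.
rewrite -lee_fin EFinD !fineK ?esum_b_past_fin_num//.
rewrite -[X in (_ + X <= _)%E](@esum_set1 _ _ g (fun h => (b_past P w h)%:E))//.
rewrite esum_mkcond [X in (_ + X <= _)%E]esum_mkcond [leRHS]esum_mkcond.
rewrite -esumD; first last.
- by move=> h _; case: ifP.
- by move=> h _; case: ifP.
apply: le_esum => h _; case: ifPn => [|_].
  rewrite inE => Ah; rewrite ifF ?adde0; first by rewrite ifT// inE; exact: AB.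
  by apply/negbTE; rewrite notin_setE /= => hg; apply: nAg; rewrite -hg.
rewrite add0e; case: ifPn => [|_]; last by case: ifP.
by rewrite inE /= => ->; rewrite ifT// inE.
Qed.

(** The intervals are laid end to end in the lexicographic order of (l, pickle g): the right end of
    the earlier one is at most the left end of the later one, the lengths being nonnegative. *)
Lemma B_interval_inj l l' g g' w v :
  B_interval P l g w v -> B_interval P l' g' w v -> g = g'.
Proof.
wlog : l l' g g' / (l < l')%N || (l == l') && (pickle g < pickle g')%N.
  move=> W hg hg'; have [ll|ll|ll] := ltngtP l l'.
  - by apply: W hg hg'; rewrite ll.
  - by apply/esym; apply: W hg' hg; rewrite ll.
  - have [gg|gg|gg] := ltngtP (pickle g) (pickle g').
    + by apply: W hg hg'; rewrite ll eqxx gg orbT.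
    + by apply/esym; apply: W hg' hg; rewrite ll eqxx gg orbT.
    + exact: (pcan_inj pickleK).
rewrite /B_interval /= !in_itv /= => ll /andP[_ v1] /andP[v2 _].
exfalso; move: (le_lt_trans v2 v1); apply/negP; rewrite -leNgt.
pose mass j := fine (\esum_(h in [set: G]) (b_past P (take j w) h)%:E)%E.
have mass_ge0 j : 0 <= mass j.
  by apply: fine_ge0; apply: esum_ge0 => h _; rewrite lee_fin b_past_ge0.
case/orP: ll => [ll|/andP[/eqP <- gg]].
  apply: le_trans (_ : _ <= \sum_(j < l') mass j) _; last first.
    rewrite lerDl; apply: fine_ge0; apply: esum_ge0 => h _.
    by rewrite lee_fin b_past_ge0.
  have -> : \sum_(j < l') mass j =
      \sum_(j < l.+1) mass j + \sum_(l.+1 <= j < l') mass j.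
    by rewrite -!(big_mkord xpredT) -big_cat_nat.
  rewrite big_ord_recr/= -!addrA lerD2l; apply: ler_wpDr; last first.
    by apply: esum_b_past_add1 => //=; rewrite ltnn.
  by rewrite sumr_ge0.
rewrite -addrA lerD2l; apply: esum_b_past_add1 => //=; first by rewrite ltnn.
by move=> h hg; exact: ltn_trans hg gg.
Qed.

(** By [B_interval_inj] the choice made by [xget] is either the only possible symbol or the default
    [g0], so no arbitrary choice enters the event. *)
Lemma measurable_next_symbol w g :
  measurable [set v | next_symbol P g0 w v = g].
Proof.
pose D g v := exists2 l : nat, (l <= size w)%N & B_trunc P l g w v.
have mD h : measurable [set v | D h v].
  rewrite (_ : mkset _ = [set v | exists l, (l <= size w)%N /\ B_trunc P l h w v]).
    apply: measurable_ex => l; apply: measurable_conj.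
      exact: measurable_const.
    by apply: measurableI; exact: measurable_itv.
  by apply/seteqP; split=> v /= [l]; [exists l|case; exists l].
have Dinj h h' v : D h v -> D h' v -> h = h'.
  by move=> [l _ [_ +]] [l' _ [_ +]]; exact: B_interval_inj.
rewrite (_ : mkset _ = [set v | D g v \/ (g0 = g /\ forall h, ~ D h v)]).
  apply: measurable_disj => //; apply: measurable_conj.
    exact: measurable_const.
  by apply: measurable_all => h; exact: measurable_not.
apply/seteqP; split=> v /=; rewrite /next_symbol.
  case: xgetP => [h _ Dh <-|nD <-]; first by left.
  by right; split=> // h; exact: nD.
move=> [Dg|[<- nD]].
  by case: xgetP => [h _ Dh|/(_ g)]; [exact: Dinj Dh Dg|case].
by case: xgetP => [h _ /nD|].
Qed.

Local Notation a := (a_ P).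

Lemma symbols_from_ext (u u' : trajectory R) m n :
  (forall k, m <= k -> k < m + n%:Z -> u k = u' k) ->
  symbols_from P g0 u m n = symbols_from P g0 u' m n.
Proof.
elim: n => [//|n IH] e /=; rewrite IH; first by rewrite e//; lia.
by move=> k mk kn; apply: e; lia.
Qed.

Lemma symbols_from_shift h (u : trajectory R) m n :
  symbols_from P g0 (shift h u) m n = symbols_from P g0 u (m + h) n.
Proof.
elim: n => [//|n IH] /=; rewrite IH /shift; congr (next_symbol _ _ _ (u _) :: _).
lia.
Qed.

Lemma measurable_symbols_from m n s :
  measurable [set u : trajectory R | symbols_from P g0 u m n = s].
Proof.
elim: n s => [|n IH] s /=; first exact: measurable_const.
case: s => [|g s]; first by rewrite (_ : mkset _ = set0)//; apply/seteqP; split.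
rewrite (_ : mkset _ = [set u : trajectory R | symbols_from P g0 u m n = s /\
    next_symbol P g0 s (u (m + n%:Z)) = g]); last first.
  by apply/seteqP; split=> u /= => [[<- <-]|[-> ->]].
apply: measurable_conj; first exact: IH.
exact: (measurable_coord _ (measurable_next_symbol s g)).
Qed.

Let last_regen (u : trajectory R) (n m : int) := is_max [set m : int | m <= n /\
    forall k : int, m <= k -> (k%:E <= n%:E)%E -> u k < a `|k - m|%N] m.

Lemma Phi_tau (u : trajectory R) n m : last_regen u n m ->
  Phi P g0 u n = head g0 (symbols_from P g0 u m `|n - m|.+1).
Proof. by move=> /(tauP a u n n%:E m) e; rewrite /Phi e. Qed.

Lemma Phi_no_tau (u : trajectory R) n : (forall m, ~ last_regen u n m) ->
  Phi P g0 u n = g0.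
Proof.
move=> nm; rewrite /Phi; case E : (tau _ _ _ _) => [m||] //.
by case: (nm m); exact/(tauP a u n n%:E m).
Qed.

Lemma last_regen_shift h (u : trajectory R) n m :
  last_regen (shift h u) n m <-> last_regen u (n + h) (m + h).
Proof.
split=> -[[mn hm] mmax]; split.
- split; first lia.
  move=> k mk kn; have := hm (k - h); rewrite /shift subrK.
  rewrite (_ : k - (m + h) = k - h - m); last lia.
  by apply; [lia|move: kn; rewrite !lee_fin; lia].
- move=> m' [mn' hm']; rewrite -lerBlDr; apply: mmax.
  split; first lia.
  move=> k mk kn; rewrite /shift.
  rewrite (_ : k - (m' - h) = k + h - m'); last lia.
  by apply: hm'; [lia|move: kn; rewrite !lee_fin; lia].
- split; first lia.
  move=> k mk kn; rewrite /shift (_ : k - m = k + h - (m + h)); last lia.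
  by apply: hm; [lia|move: kn; rewrite !lee_fin; lia].
- move=> m' [mn' hm']; rewrite -(lerD2r h); apply: mmax.
  split; first lia.
  move=> k mk kn; have := hm' (k - h); rewrite /shift subrK.
  rewrite (_ : k - (m' + h) = k - h - m'); last lia.
  by apply; [lia|move: kn; rewrite !lee_fin; lia].
Qed.

Lemma Phi_shift h (u : trajectory R) n :
  Phi P g0 (shift h u) n = Phi P g0 u (n + h).
Proof.
have [[m hm]|nm] := pselect (exists m, last_regen (shift h u) n m).
  rewrite (Phi_tau hm); move/last_regen_shift : hm => /Phi_tau ->.
  rewrite symbols_from_shift (_ : n + h - (m + h) = n - m)//; lia.
rewrite !Phi_no_tau// => m hm; apply: nm.
  by exists (m - h); apply/last_regen_shift; rewrite subrK.
by exists m.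
Qed.

(** The hypothesis makes [i] a candidate for tau[n], so tau[n] >= i; both tau[n] and the recursion
    started there then read only coordinates in [i,n]. *)
Lemma Phi_local (u u' : trajectory R) i n : i <= n -> below a u i (n + 1) ->
  (forall k, i <= k <= n -> u k = u' k) -> Phi P g0 u n = Phi P g0 u' n.
Proof.
move=> iN hb e.
pose S (v : trajectory R) (m : int) := m <= n /\
  forall k : int, m <= k -> (k%:E <= n%:E)%E -> v k < a `|k - m|%N.
have SE m : i <= m -> S u m <-> S u' m.
  move=> im; split=> -[mn hm]; split=> // k mk kn; have := hm k mk kn.
    by rewrite e//; rewrite lee_fin in kn; lia.
  by rewrite -e//; rewrite lee_fin in kn; lia.
have Si : S u i.
  by split=> // k ik; rewrite lee_fin => kn; apply: hb => //; lia.
have [m [im [Sm mmax]]] : exists m, i <= m /\ is_max [set m | S u m] m.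
  (* The maximal candidate is found as [n - j] with [j] minimal. *)
  have ex : exists j : nat, `[< S u (n - j%:Z) >].
    exists (absz (n - i)%R); apply/asboolP.
    by rewrite (_ : n - _ = i)//; lia.
  case: (ex_minnP ex) => j /asboolP Sj min.
  have jmax m : S u m -> m <= n - j%:Z.
    move=> Sm; have mn := Sm.1; have := min (absz (n - m)%R).
    rewrite (_ : n - (absz (n - m)%R)%:Z = m); last lia.
    by move=> /(_ (asboolT Sm)); lia.
  by exists (n - j%:Z); split; [exact: jmax|split].
(* The same [m] is maximal for [u']: candidates from [i] on coincide, and earlier ones are below
   [m]. *)
rewrite (Phi_tau (m := m)) ?(Phi_tau (u := u') (m := m))//; last first.
  split; first exact/SE.
  move=> m' Sm'; have [im'|] := leP i m'; first by apply: mmax; exact/SE.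
  by move=> /ltW m'i; exact: le_trans m'i im.
congr head; apply: symbols_from_ext => k mk km; apply: e.
by have := Sm.1; lia.
Qed.

Lemma measurable_Phi n g : measurable [set u : trajectory R | Phi P g0 u n = g].
Proof.
have mS m : measurable [set u : trajectory R | m <= n /\
    forall k : int, m <= k -> (k%:E <= n%:E)%E -> u k < a `|k - m|%N].
  apply: measurable_conj; first exact: measurable_const.
  apply: measurable_all => k; do 2 apply: measurable_imp.
  exact: measurable_lt_coord.
have mL m : measurable [set u : trajectory R | last_regen u n m].
  apply: measurable_conj; first exact: mS.
  rewrite (_ : mkset _ = [set u : trajectory R | forall i : int, ~ (i <= n /\
      forall k : int, i <= k -> (k%:E <= n%:E)%E -> u k < a `|k - i|%N) \/
      i <= m]).
    apply: measurable_all => i; apply: measurable_disj.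
      exact: measurable_not.
    exact: measurable_const.
  apply/seteqP; split=> u /= h i; last by move=> Si; case: (h i).
  by have [/h|] := pselect (i <= n /\
    forall k : int, i <= k -> (k%:E <= n%:E)%E -> u k < a `|k - i|%N);
    [right|left].
rewrite (_ : mkset _ = [set u : trajectory R | (exists m, last_regen u n m /\
    exists s, head g0 s = g /\ symbols_from P g0 u m `|n - m|.+1 = s) \/
    (g0 = g /\ forall m, ~ last_regen u n m)]).
  apply: measurable_disj.
    apply: measurable_ex => m; apply: measurable_conj => //.
    apply: measurable_ex => s; apply: measurable_conj.
      exact: measurable_const.
    exact: measurable_symbols_from.
  apply: measurable_conj; first exact: measurable_const.
  by apply: measurable_all => m; exact: measurable_not.
apply/seteqP; split=> u /=.
  have [[m hm]|nm] := pselect (exists m, last_regen u n m).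
    rewrite (Phi_tau hm) => hg; left; exists m; split=> //.
    by exists (symbols_from P g0 u m `|n - m|.+1).
  rewrite Phi_no_tau; first by right; split=> // m hm; apply: nm; exists m.
  by move=> m hm; apply: nm; exists m.
move=> [[m [hm [s [<- <-]]]]|[<- nm]]; first by rewrite (Phi_tau hm).
exact: Phi_no_tau.
Qed.

End kernel.

(** * Transfer from the law of the trajectory to the variables [U] *)

Lemma uniform_prob_lt (R : realType) (x : R) : 0 <= x -> x <= 1 ->
  uniform_prob (@ltr01 R) [set` `]-oo, x[%R] = x%:E.
Proof.
move=> x0 x1; rewrite /uniform_prob integral_uniform_pdf.
rewrite (eq_integral (fun=> 1%E)); last first.
  move=> y; rewrite inE => -[_ /=]; rewrite in_itv/= /uniform_pdf => ->.
  by rewrite subr0 invr1.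
rewrite (_ : _ `&` _ = [set` `[0, x[%R]); last first.
  apply/seteqP; split=> y /=; rewrite !in_itv/=; first by case=> -> /andP[->].
  by move=> /andP[y0 yx]; rewrite yx y0 (le_trans (ltW yx)).
rewrite integral_cst//= mul1e lebesgue_measure_itv/= lte_fin oppr0 addr0.
by case: ltP => // x_le0; congr (_%:E); apply/le_anti; rewrite x0 x_le0.
Qed.

Theorem corollary4p18 (R : realType) (G : countType) (P : G -> history G -> R)
    (g0 : G) (d : measure_display) (T : measurableType d)
    (Pr : probability T R) (U : int -> {RV Pr >-> R})
    (hP : transition_kernel P) (hU : iid_uniform01 U) (hbeta : 0 < beta P) :
  let u := fun (w : T) (i : int) => U i w in
  let N := fun w : T => regeneration (a_ P) (u w) in
  let xi := fun (l : int) (w : T) => block P g0 (u w) l in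
  [/\ stationary_renewal Pr N,
      forall (l : int) (m : nat), l != 0 -> (0 < m)%N ->
        Pr [set w | m%:Z <= event_times (N w) (l + 1) - event_times (N w) l]
        = rho (a_ P) m.-1,
      mutually_independent Pr (discrete_measurable (T := seq G)) xi &
      identically_distributed Pr [set l : int | l != 0]
        (discrete_measurable (T := seq G)) xi].
Proof.
move=> u N xi; set a := a_ P.
have a_ge0 n : 0 <= a n := a_ge0 g0 hP n.
have a_le1 n : a n <= 1 := a_le1 g0 hP n.
have a_nd m n : (m <= n)%N -> a m <= a n := @a_nondecreasing _ _ _ g0 hP m n.
have mu : measurable_fun setT (u : T -> trajectory R).
  apply: measurable_into_trajectory => i B mB.
  rewrite -[X in measurable X]setTI.
  exact: (measurable_funPT (U i)).
pose uu : {mfun T >-> trajectory R} := HB.pack (u : T -> trajectory R)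
  (@isMeasurableFun.Build _ _ _ _ (u : T -> trajectory R) mu).
(* The law of the whole sequence [U], to which the results on trajectories apply. *)
pose Q : probability (trajectory R) R := distribution Pr uu.
have iidQ (s : seq int) (A : int -> set R) : uniq s ->
    (forall i, measurable (A i)) ->
    Q (\bigcap_(i in [set` s]) [set v : trajectory R | A i (v i)]) =
    (\prod_(i <- s) uniform_prob (@ltr01 R) (A i))%E.
  move=> us mA; rewrite -(eq_bigr _ (fun i _ => hU.2 i (A i) (mA i))).
  by rewrite -(hU.1.2 s A us mA).
have lam_lt n : uniform_prob (@ltr01 R) [set` `]-oo, a n[%R] = (a n)%:E.
  exact: uniform_prob_lt.
have b_gt0 : (0 < regen_prob a Q)%E.
  exact: (regen_prob_gt0 a_ge0 a_le1 iidQ lam_lt).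
have mpsi := measurable_Phi g0 hP.
have psi_shift h v n := Phi_shift P g0 h v n.
have psi_local v v' i n := @Phi_local _ _ P g0 v v' i n.
have xiQ l B : Pr (xi l @^-1` B) =
    Q [set v | B (nth_block a (Phi P g0) v l)] by [].
have mxi l B : measurable (xi l @^-1` B).
  have := measurable_nth_block a_nd mpsi l B.
  by move=> /(mu measurableT); rewrite setTI.
(* Valid on every sample: where no enumeration exists, [event_times] is the identity and both sides
   are 1. The gaps thus inherit independence and common law from the blocks. *)
have gapE l w : gap (N w) l = (size (xi l w))%:Z.
  rewrite /xi /block size_map size_iota /gap -/(N w) /event_times.
  case: xgetP => [t _ [_ lt_t _]|_]; last lia.
  by have := lt_t l; lia.
have indep_xi : mutually_independent Pr (discrete_measurable (T := seq G)) xi.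
  split=> [l A _|s A us _]; first exact: mxi.
  rewrite (eq_bigr (fun l => nth_law a Q (Phi P g0) l (A l))); last first.
    move=> l _; rewrite xiQ.
    exact: (probability_nth_block a_nd iidQ b_gt0 mpsi psi_shift psi_local).
  exact: (probability_nth_blocks a_nd iidQ b_gt0 mpsi psi_shift psi_local).
have law_xi l B : l != 0 -> Pr (xi l @^-1` B) = block_law a Q (Phi P g0) B.
  move=> l0; rewrite xiQ.
  rewrite (probability_nth_block a_nd iidQ b_gt0 mpsi psi_shift psi_local).
  by rewrite /nth_law ifN.
split=> //.
- split.
  + split=> [j|s x h].
      have := measurable_regen a j => /(mu measurableT); rewrite setTI.
      by congr (measurable _); apply: eq_set => w; rewrite propeqE regenerationP.
    exact: (regeneration_stationary a iidQ s x h).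
  + have := recurrent_ae iidQ b_gt0.
    have mr : measurable [set v | ~ recurrent a v].
      by apply: measurable_not; exact: measurable_recurrent.
    move=> /(measure_negligible mr) Q0.
    exists (u @^-1` [set v | ~ recurrent a v]); split=> //.
      by have := mu measurableT _ mr; rewrite setTI.
    by move=> w /= hw ru; apply: hw; exact: recurrent_event_times.
  + split=> [l A _|s A us _].
      rewrite (_ : _ @^-1` A = xi l @^-1` [set s | A (size s)%:Z]).
        exact: mxi.
      by apply: eq_set => w; rewrite gapE.
    have gapP i : (fun w => gap (N w) i) @^-1` A i =
        xi i @^-1` [set s | A i (size s)%:Z].
      by apply: eq_set => w; rewrite gapE.
    rewrite (eq_bigcapr (fun i _ => gapP i)) (eq_bigr _ (fun i _ => congr1 Pr (gapP i))).
    by apply: (indep_xi.2 s (fun i => [set s | A i (size s)%:Z])).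
  + move=> i j i0 j0 A _.
    have gapP l : (fun w => gap (N w) l) @^-1` A =
        xi l @^-1` [set s | A (size s)%:Z].
      by apply: eq_set => w; rewrite gapE.
    by rewrite !gapP !law_xi.
(* With m+1 in place of m, a gap of at least m+1 means a block of size greater than [m], whence
   [rho a m]. *)
- move=> l [//|m] l0 _ /=.
  rewrite -(block_law_size_rho a_nd a_ge0 a_le1 iidQ lam_lt b_gt0 mpsi psi_shift
    psi_local) -(law_xi l)//.
  congr (Pr _); apply: eq_set => w; rewrite -/(gap (N w) l) gapE.
  by rewrite lez_nat.
- by move=> i j i0 j0 A _; rewrite !law_xi.
Qed.
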